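(* Let $n\ge 2$ and let $p\in\mathbb{R}$ be such that $p\ge 0$ or $p<-n$. For all $k,m\in\mathbb{N}$, $\mathcal{W}^p_{m,k}$ and $\mathcal{V}^p_k$ are valuations on the set $\mathcal{C}^n$.
   Context: $\mathbb{N}=\{1,2,\dots\}$. A convex body is a compact convex subset of $\mathbb{R}^n$ with nonempty interior; $\mathcal{K}^n_o$ is the set of convex bodies in $\mathbb{R}^n$ containing the origin in their interior. For a convex body $K$ and $x\in\partial K$, $N(x)$ is the outer unit normal of $K$ at $x$ (unique for $\mathcal{H}^{n-1}$-almost all $x$), $k_1(x),\dots,k_{n-1}(x)$ are the (generalized) principal curvatures, which exist for $\mathcal{H}^{n-1}$-almost all $x\in\partial K$, and $H_j=\binom{n-1}{j}^{-1}\sum_{1\le i_1<\dots<i_j\le n-1}k_{i_1}\cdots k_{i_j}$ for $1\le j\le n-1$, $H_0=1$. $\mathcal{H}^{n-1}$ is the surface area measure on $\partial K$. $B^n_2(y,r)$ is the closed Euclidean ball with center $y$ and radius $r$. $K$ admits an inner rolling ball if there is $r>0$ with $B^n_2(x-rN(x),r)\subseteq K$ for every $x\in\partial K$, and an outer rolling ball if there is $R>0$ with $K\subseteq B^n_2(x-RN(x),R)$ for every $x\in\partial K$ (where $N(x)$ is an outer unit normal at $x$). $\mathcal{C}^n$ is the set of $K\in\mathcal{K}^n_o$ admitting both an inner and an outer rolling ball. For $\alpha\in\mathbb{R}$: $\binom{\alpha}{0}=1$, $\binom{\alpha}{k}=\frac{\alpha(\alpha-1)\cdots(\alpha-k+1)}{k!}$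 for integers $k>0$, and $\binom{\alpha}{k}=0$ for $k<0$. For non-negative integers $i_1,\dots,i_{n-1}$ with $i_1+2i_2+\dots+(n-1)i_{n-1}=m$ put $$c(n,p,i(m))=\binom{\frac{n}{n+p}}{i_1+\dots+i_{n-1}}\frac{(i_1+\dots+i_{n-1})!}{i_1!\,i_2!\cdots i_{n-1}!}.$$ For real $p\ne -n$ and integers $k,m\ge 0$, $$\mathcal{W}^p_{m,k}(K)=\int_{\partial K}\langle x,N(x)\rangle^{m-k+\frac{n(1-p)}{n+p}}H_{n-1}^{\frac{p}{n+p}}\sum_{\substack{i_1,\dots,i_{n-1}\ge 0\\ i_1+2i_2+\dots+(n-1)i_{n-1}=m}}c(n,p,i(m))\prod_{j=1}^{n-1}\binom{n-1}{j}^{i_j}H_j^{i_j}\,d\mathcal{H}^{n-1},$$ and the $L_p$-Steiner quermassintegrals are $$\mathcal{V}^p_k(K)=\sum_{m=0}^{k}\binom{\frac{n(1-p)}{n+p}}{k-m}\mathcal{W}^p_{m,k}(K).$$ A functional $\mu$ is a valuation on $\mathcal{C}^n$ if $\mu(K\cup L)+\mu(K\cap L)=\mu(K)+\mu(L)$ for all $K,L\in\mathcal{C}^n$ with $K\cup L$ convex. *)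

(* Defs.v *)
From HB Require Import structures.
From mathcomp Require Import all_boot all_order all_algebra.
From mathcomp Require Import all_classical all_reals all_analysis.

Set Implicit Arguments.
Unset Strict Implicit.
Unset Printing Implicit Defensive.

Import Order.TTheory GRing.Theory Num.Theory.
Import numFieldNormedType.Exports.

Local Open Scope classical_set_scope.
Local Open Scope ring_scope.

(* The library norm of 'rV[R]_n is the sup norm; it induces the usual topology
   (compact, interior, closure, filters), but every metric notion below goes
   through the Euclidean norm enorm. *)

Section euclidean.
Variables (R : realType) (n : nat).
Local Notation V := 'rV[R]_n.
Implicit Types (x y u : V) (A K : set V).

Definition dot x y : R := \sum_(i < n) x 0 i * y 0 i.

Definition enorm x : R := Num.sqrt (dot x x).

Definition eball y (r : R) : set V := [set z | enorm (z - y) <= r].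

Definition bnd A : set V := closure A `\` interior A.

Definition ediam A : \bar R :=
  ereal_sup [set (enorm (x - y))%:E | x in A & y in A].

End euclidean.

(* Volume of the unit ball of R^d, by omega_d = (2 pi / d) omega_(d-2). *)
Fixpoint ball_volume (R : realType) (d : nat) : R :=
  match d with
  | 0 => 1
  | 1 => 2
  | d'.+2 => 2 * pi / d'.+2%:R * ball_volume R d'
  end.

(* Hausdorff measure, normalized so that the d-dimensional one is Lebesgue
   measure on R^d. *)

Section hausdorff.
Variables (R : realType) (n d : nat).
Local Notation V := 'rV[R]_n.
Implicit Types (A U : set V) (F : (set V)^nat).
Local Open Scope ereal_scope.

(* The empty set costs nothing, also when d = 0. Only used when the diameter is
   finite, see hausdorff_cover. *)
Definition hausdorff_gauge U : \bar R :=
  if U == set0 then 0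
  else (ball_volume R d * (fine (ediam U) / 2) ^+ d)%R%:E.

Definition hausdorff_cover (delta : R) A : set (set V)^nat :=
  [set U | (forall i, ediam (U i) <= delta%:E) /\ A `<=` \bigcup_i U i].

Definition hausdorff_pre (delta : R) A : \bar R :=
  ereal_inf [set \sum_(i <oo) hausdorff_gauge (U i)
            | U in hausdorff_cover delta A].

Definition hausdorff A : \bar R :=
  ereal_sup [set hausdorff_pre delta A | delta in [set e : R | (0 < e)%R]].

Lemma ball_volume_ge0 k : (0 <= ball_volume R k)%R.
Proof.
suff [] : ((0 <= ball_volume R k) /\ (0 <= ball_volume R k.+1))%R by [].
elim: k => [|k [IH1 IH2]] //=; split => //.
by rewrite mulr_ge0// divr_ge0// mulr_ge0// pi_ge0.
Qed.

Lemma ediam_ge0 U : U !=set0 -> 0 <= ediam U.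
Proof.
move=> [x Ux]; apply: ereal_sup_ubound; exists x => //; exists x => //.
congr (_%:E); rewrite /enorm/dot subrr big1 ?sqrtr0// => i _.
by rewrite mxE mul0r.
Qed.

Lemma hausdorff_gauge_ge0 U : 0 <= hausdorff_gauge U.
Proof.
rewrite /hausdorff_gauge; case: eqP => // /eqP/set0P U0.
by rewrite lee_fin mulr_ge0 ?ball_volume_ge0// exprn_ge0// divr_ge0// fine_ge0//
  ediam_ge0.
Qed.

Lemma hausdorff_gauge0 : hausdorff_gauge set0 = 0.
Proof. by rewrite /hausdorff_gauge eqxx. Qed.

Lemma ediam0 : ediam (set0 : set V) = -oo.
Proof.
rewrite /ediam (_ : [set _ | _ in _ & _ in _] = set0) ?ereal_sup0//.
by rewrite -subset0 => ? [].
Qed.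

Lemma hausdorff_pre_ge0 delta A : 0 <= hausdorff_pre delta A.
Proof.
apply: le_ereal_inf_tmp => _ [U _ <-].
by apply: nneseries_ge0 => *; exact: hausdorff_gauge_ge0.
Qed.

Lemma hausdorff_pre0 delta : hausdorff_pre delta set0 = 0.
Proof.
apply/eqP; rewrite eq_le hausdorff_pre_ge0 andbT.
apply: ereal_inf_lbound; exists (fun=> set0).
  by split=> // i; rewrite ediam0 leNye.
by rewrite eseries0// => i _ _; rewrite hausdorff_gauge0.
Qed.

Lemma le_hausdorff_pre delta A B :
  A `<=` B -> hausdorff_pre delta A <= hausdorff_pre delta B.
Proof.
move=> AB; apply/ereal_inf_le_tmp => _ [U [dU BU] <-].
by exists U => //; split => //; exact: subset_trans AB BU.
Qed.

Lemma hausdorff_pre_sigma_subadditive delta :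
  sigma_subadditive (hausdorff_pre delta).
Proof.
move=> A; have [[i ioo]|] := pselect (exists i, hausdorff_pre delta (A i) = +oo).
  rewrite (eseries_pinfty _ _ ioo) ?leey// => k _.
  by rewrite -ltNye (lt_le_trans _ (hausdorff_pre_ge0 _ _)).
rewrite -forallNE => Aoo.
suff add2e (e : {posnum R}) : hausdorff_pre delta (\bigcup_k A k) <=
    \sum_(i <oo) hausdorff_pre delta (A i) + e%:num%:E.
  by apply/lee_addgt0Pr => _/posnumP[].
rewrite (le_trans _ (epsilon_trick _ _ _))//; last first.
  by move=> k; exact: hausdorff_pre_ge0.
pose P k (B : (set V)^nat) := hausdorff_cover delta (A k) B /\
  \sum_(j <oo) hausdorff_gauge (B j) <=
  hausdorff_pre delta (A k) + (e%:num / (2 ^ k.+1)%:R)%:E.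
have [G PG] : {G : ((set V)^nat)^nat & forall k, P k (G k)}.
  apply: (@choice _ _ P) => k; rewrite /P /hausdorff_pre.
  set S := (X in ereal_inf X); move infS : (ereal_inf S) => iS.
  case: iS infS => [r Sr|Soo|Soo].
  - have en1 : (0 < e%:num / (2 ^ k.+1)%:R)%R by [].
    have /(lb_ereal_inf_adherent en1) : ereal_inf S \is a fin_num by rewrite Sr.
    move=> [x [B cB muBx] xS].
    by exists B; split => //; rewrite muBx -Sr; exact/ltW.
  - by have := Aoo k; rewrite /hausdorff_pre Soo.
  - have := hausdorff_pre_ge0 delta (A k).
    by rewrite /hausdorff_pre -/S Soo.
have muG_ge0 x : 0 <= (hausdorff_gauge \o uncurry G) x
  by exact: hausdorff_gauge_ge0.
apply: (@le_trans _ _ (\esum_(i in setT) (hausdorff_gauge \o uncurry G) i)).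
  rewrite /hausdorff_pre; apply: ereal_inf_lbound => /=.
  have /card_esym/ppcard_eqP[f] := card_nat2.
  exists (uncurry G \o f).
    split => [i /=|].
      by case: (f i) => a b /=; exact: (PG a).1.1.
    move=> t [i _ /((PG i).1.2)] [j _ Bijt].
    by exists (f^-1%FUN (i, j)) => //=; rewrite invK ?inE.
  rewrite -(esum_pred_image (hausdorff_gauge \o uncurry G) _ xpredT)
    ?[fun=> _]set_true//.
  by rewrite image_eq.
rewrite (_ : esum _ _ = \sum_(i <oo) \sum_(j <oo) hausdorff_gauge (G i j));
    last first.
  pose J : nat -> set (nat * nat) := fun i => [set (i, j) | j in setT].
  rewrite (_ : setT = \bigcup_k J k); last first.
    by rewrite predeqE => -[a b]; split => // _; exists a => //; exists b.
  rewrite esum_bigcupT /=; last 2 first.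
    - apply/trivIsetP => i j _ _ ij.
      rewrite predeqE => -[k m] /=; split => //= -[] [_] _ [<-{k} _].
      by move=> [m' _] [] /esym/eqP; rewrite (negbTE ij).
    - by move=> x; exact: (muG_ge0 x).
  rewrite -(image_id [set: nat]) -fun_true esum_pred_image//; last first.
    by move=> k _; apply: esum_ge0 => x _; exact: (muG_ge0 x).
  apply: eq_eseriesr => /= j _.
  rewrite -(esum_pred_image (hausdorff_gauge \o uncurry G) (pair j) predT)//=;
    last 2 first.
    - by move=> x *; exact: (muG_ge0 (j, x)).
    - by move=> ? ? _ _; exact: (@can_inj _ _ _ snd).
  by congr esum; rewrite predeqE => -[a b]; split; move=> [i _ <-]; exists i.
apply: lee_lim.
- apply: is_cvg_nneseries => k *.
  by apply: nneseries_ge0 => m *; exact: (muG_ge0 (k, m)).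
- apply: is_cvg_nneseries => k *; apply: adde_ge0 => //.
  exact: hausdorff_pre_ge0.
- by near=> k; apply: lee_sum => i _; exact: (PG i).2.
Unshelve. all: by end_near. Qed.

Lemma hausdorff_pre_le delta A :
  (0 < delta)%R -> hausdorff_pre delta A <= hausdorff A.
Proof. by move=> d0; apply: ereal_sup_ubound; exists delta. Qed.

Lemma hausdorff_ge0 A : 0 <= hausdorff A.
Proof.
exact: le_trans (hausdorff_pre_ge0 1%R A) (hausdorff_pre_le A ltr01).
Qed.

Lemma hausdorff0 : hausdorff set0 = 0.
Proof.
apply/eqP; rewrite eq_le hausdorff_ge0 andbT.
by apply: ge_ereal_sup => _ [e _ <-]; rewrite hausdorff_pre0.
Qed.

Lemma le_hausdorff : {homo hausdorff : A B / A `<=` B >-> A <= B}.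
Proof.
move=> A B AB; apply: ge_ereal_sup => _ [e e0 <-].
exact: le_trans (le_hausdorff_pre e AB) (hausdorff_pre_le B e0).
Qed.

Lemma hausdorff_sigma_subadditive : sigma_subadditive hausdorff.
Proof.
move=> F; apply: ge_ereal_sup => _ [e e0 <-].
apply: le_trans (hausdorff_pre_sigma_subadditive e F) _.
apply: lee_nneseries => i _ *; first exact: hausdorff_pre_ge0.
exact: hausdorff_pre_le.
Qed.

HB.instance Definition _ := isOuterMeasure.Build R V hausdorff
  hausdorff0 hausdorff_ge0 le_hausdorff hausdorff_sigma_subadditive.

(* Hausdorff measure on the sigma-algebra of its Caratheodory measurable sets
   (which contains the Borel sets). *)
Definition hausdorff_measure :
  {measure set (caratheodory_type (hausdorff : {outer_measure set V -> \bar R}))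
     -> \bar R} :=
  (hausdorff : {outer_measure set V -> \bar R}).

End hausdorff.

Section convex_bodies.
Variables (R : realType) (n : nat).
Local Notation V := 'rV[R]_n.
Implicit Types (x y u : V) (K L : set V).

Definition convex_body K := [/\ compact K, @convex_set R V K & K° !=set0].

Definition convex_body_o K := convex_body K /\ K° 0.

Definition outer_unit_normal K x u :=
  enorm u = 1 /\ forall y, K y -> dot (y - x) u <= 0.

(* A choice of outer unit normal; at almost every boundary point of a convex
   body, and at every one if it has an inner rolling ball, there is only one. *)
Definition normal K x : V := xget 0 [set u | outer_unit_normal K x u].

Definition inner_rolling_ball K := exists2 r : R, 0 < r &
  forall x, bnd K x -> eball (x - r *: normal K x) r `<=` K.

Definition outer_rolling_ball K := exists2 r : R, 0 < r &
  forall x, bnd K x -> K `<=` eball (x - r *: normal K x) r.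

Definition rolling_bodies : set (set V) :=
  [set K | [/\ convex_body_o K, inner_rolling_ball K & outer_rolling_ball K]].

(* Near x, the boundary of K is the graph of bnd_graph K x over the tangent
   hyperplane, with heights measured along the inner normal. *)
Definition bnd_line K x y : set R := [set t | K (x + y - t *: normal K x)].

Definition bnd_graph K x y : R := inf (bnd_line K x y).

(* The rows of E are an orthonormal basis of the tangent hyperplane. In these
   coordinates the convex function bnd_graph K x is twice differentiable at 0
   in Alexandrov's sense, with Hessian A: it has the second-order expansion
   z |-> (z A z^T) / 2 + o(|z|^2). The generalized principal curvatures are the
   eigenvalues of A, listed with multiplicity. *)
Definition is_principal_curvatures K x (k : 'rV[R]_n.-1) :=
  exists (E : 'M[R]_(n.-1, n)) (A : 'M[R]_n.-1),
    [/\ E *m E^T = 1%:M /\ E *m (normal K x)^T = 0,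
        \forall z \near (0 : 'rV[R]_n.-1), bnd_line K x (z *m E) !=set0,
        A^T = A,
        (fun z : 'rV[R]_n.-1 =>
           bnd_graph K x (z *m E) - dot (z *m A) z / 2 : R^o)
          =o_ (0 : 'rV[R]_n.-1) (fun z : 'rV[R]_n.-1 => dot z z : R^o) &
        char_poly A = \prod_(i < n.-1) ('X - (k 0 i)%:P)].

(* Well defined up to order where the curvatures exist; 0 elsewhere. *)
Definition principal_curvatures K x : 'rV[R]_n.-1 :=
  xget 0 [set k | is_principal_curvatures K x k].

Definition mean_curvature K (j : nat) x : R :=
  'C(n.-1, j)%:R^-1 *
  \sum_(I : {set 'I_n.-1} | #|I| == j)
     \prod_(i in I) principal_curvatures K x 0 i.

End convex_bodies.

Arguments rolling_bodies R n : clear implicits.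

Definition gbinom (R : realType) (a : R) (k : nat) : R :=
  (\prod_(i < k) (a - i%:R)) / k`!%:R.

Section steiner.
Variables (R : realType) (n : nat) (p : R).
Local Notation V := 'rV[R]_n.

(* i : 'I_n.-1 -> nat lists (i_1, ..., i_(n-1)) starting from index 0. *)
Definition steiner_coef (i : 'I_n.-1 -> nat) : R :=
  gbinom (n%:R / (n%:R + p)) (\sum_j i j)%N *
  ((\sum_j i j)%N`!%:R / \prod_j (i j)`!%:R).

(* i_1 + 2 i_2 + ... = m forces every i_j <= m, so the sum is over functions
   into 'I_m.+1. *)
Definition W_density (m k : nat) (K : set V) (x : V) : R :=
  dot x (normal K x) `^ (m%:R - k%:R + n%:R * (1 - p) / (n%:R + p)) *
  mean_curvature K n.-1 x `^ (p / (n%:R + p)) *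
  \sum_(i : {ffun 'I_n.-1 -> 'I_m.+1} | (\sum_(j < n.-1) j.+1 * i j)%N == m)
     steiner_coef (fun j => i j) *
     \prod_(j < n.-1) ('C(n.-1, j.+1)%:R ^+ i j *
                       mean_curvature K j.+1 x ^+ i j).

Definition steiner_W (m k : nat) (K : set V) : R :=
  \int[hausdorff_measure R n n.-1]_(x in bnd K) W_density m k K x.

Definition steiner_V (k : nat) (K : set V) : R :=
  \sum_(m < k.+1)
     gbinom (n%:R * (1 - p) / (n%:R + p)) (k - m) * steiner_W m k K.

End steiner.

Definition valuation_on (R : realType) (n : nat) (C : set (set 'rV[R]_n))
    (mu : set 'rV[R]_n -> R) :=
  forall K L, C K -> C L -> @convex_set R 'rV[R]_n (K `|` L) ->
    mu (K `|` L) + mu (K `&` L) = mu K + mu L.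

(* Main.v *)
Require Import Defs.
From HB Require Import structures.
From mathcomp Require Import all_boot all_order all_algebra.
From mathcomp Require Import all_classical all_reals all_analysis.
From mathcomp Require Import ring lra.
Set Implicit Arguments.
Unset Strict Implicit.
Unset Printing Implicit Defensive.
Import Order.TTheory GRing.Theory Num.Theory.
Import numFieldNormedType.Exports.
Local Open Scope classical_set_scope.
Local Open Scope ring_scope.

(** The valuation property holds because both sides integrate one function over
    the same pieces. Put [U = K `|` L], [P = K `&` L] and let [E] be the set of
    common boundary points of [K] and [L]. The boundary of [U] splits into [E] and
    the parts of each boundary outside the other body; the boundary of [P] splits
    into [E] and the parts inside the other body; the boundary of [K] is made of
    [E], an outside part and an inside part ([bndU_split], [bndP_split],
    [bndK_split]). On an outside or inside part the relevant bodies coincide near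
    each point, and the density is local ([W_density_agree]). What remains is to
    see that the densities of [K], [L], [U] and [P] agree at almost every point of
    [E].

    At a point of [E] the convexity of [U] and the presence of the origin inside
    both bodies force the two normals to coincide ([common_normal]). Represent the
    boundaries as graphs over the common tangent hyperplane. If [e] in [E] is at
    distance [h] from a point of the boundary of [U], then at [e] both bodies share
    a supporting hyperplane and contain a ball of fixed radius, so the graphs of
    [U] and [P] differ there by [O(h^2)] ([osculate_dense]). Hence at a point [x]
    of [E] where [E] is not porous relative to the boundary of [U], that is where
    [h] is negligible compared with the distance to [x], the graphs of all bodies
    between [P] and [U] agree up to [o(|y|^2)]. Their second-order expansions are
    then the same, whether or not they exist, and so are the densities
    ([W_density_osculate]).

    The porous points of [E] form a null set ([not_dense_hausdorff0]). Central
    projection to the faces of a cube is bi-Lipschitz, which transports dyadic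
    cubes to the boundary. Suppose every cell has measure at most [c] times its
    volume. Each porous point lies in arbitrarily small cells having a subcell of
    fixed proportion without porous points; stopping at the first such cell
    improves the constant by a fixed factor, and iteration gives measure 0
    ([porous_null]). Translating the grid by [1 / 3] ensures that a point and the
    hole next to it lie in a common cell of comparable size.

    Finally, the integral of a function that is not known to be measurable is a
    difference of suprema over simple functions, and such lower integrals are
    additive over disjoint measurable domains ([lower_integral_setU]). The pieces
    of the boundaries are built from closed sets, which are measurable by
    Caratheodory's criterion since Hausdorff measure is a metric outer measure
    ([hausdorff_closed_measurable]). The integrals are finite because the inner
    rolling balls bound the curvatures, the boundary has finite measure
    ([bnd_hausdorff_finite]) and, by the condition on [p], the exponent of the
    Gauss curvature is nonnegative. *)

(** * Euclidean geometry of row vectors *)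

Section euclid.
Variables (R : realType) (n : nat).
Local Notation V := 'rV[R]_n.
Implicit Types (x y z u v : V) (t r : R).

Lemma dotC x y : dot x y = dot y x.
Proof. by apply: eq_bigr => i _; rewrite mulrC. Qed.

Lemma dotDl x y z : dot (x + y) z = dot x z + dot y z.
Proof. by rewrite -big_split; apply: eq_bigr => i _; rewrite mxE mulrDl. Qed.

Lemma dotZl t x y : dot (t *: x) y = t * dot x y.
Proof. by rewrite mulr_sumr; apply: eq_bigr => i _; rewrite mxE mulrA. Qed.

Lemma dotNl x y : dot (- x) y = - dot x y.
Proof. by rewrite -scaleN1r dotZl mulN1r. Qed.

Lemma dotBl x y z : dot (x - y) z = dot x z - dot y z.
Proof. by rewrite dotDl dotNl. Qed.

Lemma dotDr x y z : dot z (x + y) = dot z x + dot z y.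
Proof. by rewrite dotC dotDl !(dotC z). Qed.

Lemma dotZr t x y : dot x (t *: y) = t * dot x y.
Proof. by rewrite dotC dotZl dotC. Qed.

Lemma dotNr x y : dot x (- y) = - dot x y.
Proof. by rewrite dotC dotNl dotC. Qed.

Lemma dotBr x y z : dot z (x - y) = dot z x - dot z y.
Proof. by rewrite dotDr dotNr. Qed.

Lemma dot0l x : dot 0 x = 0.
Proof. by rewrite -(scale0r x) dotZl mul0r. Qed.

Definition dotE := (dotDl, dotDr, dotBl, dotBr, dotZl, dotZr, dotNl, dotNr).

Lemma dot_ge0 x : 0 <= dot x x.
Proof. by apply: sumr_ge0 => i _; rewrite -expr2 sqr_ge0. Qed.

Lemma enorm_ge0 x : 0 <= enorm x.
Proof. exact: sqrtr_ge0. Qed.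

Lemma sqr_enorm x : enorm x ^+ 2 = dot x x.
Proof. by rewrite sqr_sqrtr// dot_ge0. Qed.

Lemma enorm_le r x : 0 <= r -> (enorm x <= r) = (dot x x <= r ^+ 2).
Proof. by move=> r0; rewrite -sqr_enorm ler_sqr// nnegrE ?enorm_ge0. Qed.

Lemma enorm1_dot u : enorm u = 1 -> dot u u = 1.
Proof. by move=> u1; rewrite -sqr_enorm u1 expr1n. Qed.

Lemma enormN x : enorm (- x) = enorm x.
Proof. by rewrite /enorm dotNl dotNr opprK. Qed.

Lemma enormZ t x : enorm (t *: x) = `|t| * enorm x.
Proof. by rewrite /enorm dotZl dotZr mulrA -expr2 sqrtrM ?sqr_ge0// sqrtr_sqr.
  Qed.

Lemma enormB x y : enorm (x - y) = enorm (y - x).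
Proof. by rewrite -enormN opprB. Qed.

Lemma dot_le_enorm x y : dot x y <= enorm x * enorm y.
Proof.
have [x0|x0] := eqVneq (enorm x) 0.
  have xE : x = 0.
    apply/rowP => i; rewrite mxE; apply/eqP; rewrite -sqrf_eq0.
    have := sqr_enorm x; rewrite x0 expr0n /= => /esym/eqP.
    rewrite psumr_eq0 => [/allP/(_ i)|j _]; last by rewrite -expr2 sqr_ge0.
    by rewrite mem_index_enum expr2 => /(_ isT).
  by rewrite xE dot0l; apply: mulr_ge0; exact: enorm_ge0.
have xp : 0 < enorm x by rewrite lt_def x0 enorm_ge0.
have := dot_ge0 (enorm x *: y - (dot x y / enorm x) *: x).
rewrite !dotE -!sqr_enorm (dotC y x).
set a := enorm x; set b := enorm y; set c := dot x y => H.
have {}H : c ^+ 2 <= (a * b) ^+ 2.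
  rewrite -subr_ge0 (le_trans H)// le_eqVlt; apply/orP; left; apply/eqP.
  by field.
have [c0|c0] := leP c 0; first by apply: (le_trans c0);
  rewrite mulr_ge0 ?enorm_ge0.
by rewrite -ler_sqr// nnegrE ?(ltW c0) ?mulr_ge0 ?enorm_ge0.
Qed.

Lemma enormD x y : enorm (x + y) <= enorm x + enorm y.
Proof.
rewrite enorm_le ?addr_ge0 ?enorm_ge0// !dotE (dotC y x) -!sqr_enorm.
by have := dot_le_enorm x y; set a := enorm x; set b := enorm y => ?; nra.
Qed.

Lemma enorm_triangle x y z : enorm (x - z) <= enorm (x - y) + enorm (y - z).
Proof. by rewrite (le_trans _ (enormD _ _))// addrA subrK. Qed.

Lemma norm_coord x i : `|x 0 i| <= `|x|.
Proof.
rewrite [leRHS]/Num.norm /= mx_normrE; apply/bigmax_geP; right => /=.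
by exists (0, i).
Qed.

Lemma norm_le_coord r x : 0 <= r -> (forall i, `|x 0 i| <= r) -> `|x| <= r.
Proof.
move=> r0 H; rewrite [leLHS]/Num.norm /= mx_normrE; apply/bigmax_leP;
  split=> //.
by move=> [a b] _ /=; rewrite (ord1 a).
Qed.

Lemma norm_le_enorm x : `|x| <= enorm x.
Proof.
apply: norm_le_coord; first exact: enorm_ge0.
move=> i; rewrite -ler_sqr ?nnegrE ?enorm_ge0// sqr_enorm real_normK
  ?num_real//.
rewrite /dot (bigD1 i)//= expr2 lerDl; apply: sumr_ge0 => j _.
by rewrite -expr2 sqr_ge0.
Qed.

Lemma enorm_le_norm x : enorm x <= n%:R * `|x|.
Proof.
rewrite enorm_le; last by apply: mulr_ge0.
have sq : dot x x <= \sum_(i < n) `|x| ^+ 2.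
  apply: ler_sum => i _; rewrite -expr2 -[x 0 i ^+ 2]real_normK ?num_real//.
  by rewrite ler_sqr ?nnegrE// norm_coord.
rewrite (le_trans sq)// sumr_const card_ord -[leLHS]mulr_natl exprMn ler_wpM2r
  ?sqr_ge0//.
case: (n) => [|k]; first by rewrite expr0n.
by rewrite expr2 ler_peMl// ler1n.
Qed.

Lemma eball_center x r : 0 <= r -> eball x r x.
Proof.
move=> r0; rewrite /eball /=.
by rewrite subrr (_ : (0 : V) = 0 *: 0) ?enormZ ?normr0 ?mul0r ?scale0r.
Qed.

(** The topology comes from the sup norm, the metric notions from [enorm]; this
    equivalence is the bridge between them. *)
Lemma nbhs_eballP x (A : set V) :
  nbhs x A <-> exists2 r : R, 0 < r & eball x r `<=` A.
Proof.
split=> [/nbhs_ballP[e e0 xA]|[r r0 xA]].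
  exists (e / 2); first by rewrite divr_gt0.
  move=> z xz; apply: xA; rewrite -ball_normE /= distrC.
  rewrite (le_lt_trans (norm_le_enorm _))// (le_lt_trans xz)//.
  by rewrite ltr_pdivrMr// ltr_pMr// ltr1n.
apply/nbhs_ballP; exists (r / n.+1%:R); first by rewrite /= divr_gt0.
move=> z; rewrite -ball_normE /= distrC => xz; apply: xA; rewrite /eball /=.
rewrite (le_trans (enorm_le_norm _))//.
move: xz; rewrite ltr_pdivlMr// mulrC => /ltW; apply: le_trans.
by rewrite ler_wpM2r// ler_nat.
Qed.

Lemma interior_eballP x (A : set V) :
  A° x <-> exists2 r : R, 0 < r & eball x r `<=` A.
Proof. exact: nbhs_eballP. Qed.

Lemma open_eball (A : set V) x :
  open A -> A x -> exists2 r : R, 0 < r & eball x r `<=` A.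
Proof. by move=> oA Ax; apply/nbhs_eballP; exact: open_nbhs_nbhs. Qed.

Lemma closed_bndE (A : set V) : closed A -> bnd A = A `\` A°.
Proof. by move=> /closure_id A_; rewrite /bnd -A_. Qed.

Lemma convex_lerp (A : set V) x y t : @convex_set R V A ->
  A x -> A y -> 0 <= t <= 1 -> A (x + t *: (y - x)).
Proof.
move=> cA Ax Ay t01.
have /andP[t0 t1] := t01.
have := @cA y x (Itv01 t0 t1); rewrite !inE => /(_ Ay Ax).
congr A; rewrite /conv /=.
by apply/rowP => i; rewrite !mxE /unstable.onem; ring.
Qed.

End euclid.

(** * Boundary points with a touching inner ball *)

Section touch.
Variables (R : realType) (n : nat).
Local Notation V := 'rV[R]_n.
Implicit Types (x y z u N : V) (t r : R) (M K L : set V).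

(** At such a point the boundary is squeezed between a hyperplane and a sphere of
    radius [r]. This is all that is used of an inner rolling ball. *)
Definition touch M x N r :=
  [/\ 0 < r, outer_unit_normal M x N & eball (x - r *: N) r `<=` M].

Lemma touch_mem M x N r : touch M x N r -> M x.
Proof.
move=> [r0 [N1 _]]; apply; rewrite /eball /= opprB addrC subrK enormZ N1 mulr1.
by rewrite gtr0_norm.
Qed.

Lemma outer_unit_normal_Ninterior M x u : outer_unit_normal M x u -> ~ M° x.
Proof.
move=> [u1 Mu] /interior_eballP[d d0 xdM].
have := Mu (x + d *: u).
have xd : x + d *: u - x = d *: u by rewrite addrC addKr.
rewrite xd dotZl enorm1_dot// mulr1 leNgt d0 => H; apply: (negP (H _)) => //.
by apply: xdM; rewrite /eball /= xd enormZ u1 mulr1 gtr0_norm.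
Qed.

Lemma touch_bnd M x N r : closed M -> touch M x N r -> bnd M x.
Proof.
move=> cM tM; rewrite closed_bndE//; split; first exact: touch_mem tM.
by case: tM => _ /outer_unit_normal_Ninterior.
Qed.

Lemma sub_eball_touching x N r r' : enorm N = 1 -> r' <= r ->
  eball (x - r' *: N) r' `<=` eball (x - r *: N) r.
Proof.
move=> N1 rr' z; rewrite /eball /= => zr'.
have -> : z - (x - r *: N) = z - (x - r' *: N) + (r - r') *: N.
  by apply/rowP => i; rewrite !mxE; ring.
rewrite (le_trans (enormD _ _))// enormZ N1 mulr1 ger0_norm ?subr_ge0//.
by rewrite -lerBrDr subKr.
Qed.

Lemma dot0_eq0 x : dot x x <= 0 -> x = 0.
Proof.
move=> x0; apply/eqP; rewrite -normr_le0 (le_trans (norm_le_enorm _))//.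
by rewrite enorm_le// expr0n.
Qed.

(** The ball of radius [r] contains the point [x - r N + r u], which violates
    the supporting inequality for [u] unless [u = N]. *)
Lemma touch_uniq M x N r u :
  touch M x N r -> outer_unit_normal M x u -> u = N.
Proof.
move=> [r0 [N1 NM] bM] [u1 uM]; apply/eqP; rewrite -subr_eq0; apply/eqP.
apply: dot0_eq0.
have := uM (x - r *: N + r *: u).
have -> : x - r *: N + r *: u - x = r *: (u - N).
  by apply/rowP => i; rewrite !mxE; ring.
rewrite dotZl dotBl enorm1_dot// => H.
have {}H : r * (1 - dot N u) <= 0.
  by apply: H; apply: bM;
    rewrite /eball /= addrC addKr enormZ u1 mulr1 gtr0_norm.
rewrite !dotE !enorm1_dot// (dotC u N).
by move: H; rewrite pmulr_rle0// => H; lra.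
Qed.

Lemma touch_normal M x N r : touch M x N r -> normal M x = N.
Proof.
move=> tM; rewrite /normal; case: xgetP => [u _|/(_ N)].
  exact: touch_uniq tM.
by case: tM => _ ? _ [].
Qed.

(** If no outer normal existed, the junk value 0 would put a ball around [x]
    inside [M]. *)
Lemma rolling_touch M x r : 0 < r -> bnd M x ->
  eball (x - r *: normal M x) r `<=` M -> touch M x (normal M x) r.
Proof.
move=> r0 [_ Mx]; rewrite /normal; case: xgetP => [u _ ou bM|_].
  by split.
rewrite scaler0 subr0 => bM; exfalso; apply: Mx.
by apply/interior_eballP; exists r.
Qed.

Lemma touch_cap_mem x N r y t : enorm N = 1 -> dot y N = 0 -> 0 <= r ->
  dot y y + t ^+ 2 <= 2 * t * r -> eball (x - r *: N) r (x + y - t *: N).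
Proof.
move=> N1 yN r0 H; rewrite /eball /= enorm_le//.
have -> : x + y - t *: N - (x - r *: N) = y + (r - t) *: N.
  by apply/rowP => i; rewrite !mxE; ring.
rewrite !dotE (dotC N y) yN (enorm1_dot N1); nra.
Qed.

Lemma touch_cap M x N r y : touch M x N r -> dot y N = 0 -> enorm y <= r ->
  M (x + y - (dot y y / r) *: N).
Proof.
move=> [r0 [N1 _] bM] yN; rewrite enorm_le; last exact: ltW.
move=> yr.
apply: bM; apply: touch_cap_mem (ltW r0) _ => //.
have := dot_ge0 y; set s := dot y y in yr * => s0.
have -> : 2 * (s / r) * r = 2 * s by field; rewrite gt_eqF.
rewrite -lerBrDl; have -> : 2 * s - s = s by ring.
rewrite expr_div_n ler_pdivrMr ?exprn_gt0//.
by rewrite expr2 ler_wpM2l.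
Qed.

Section line.
Variables (M : set V) (x N : V) (r : R).
Hypothesis tM : touch M x N r.

Lemma bnd_lineE y t : bnd_line M x y t = M (x + y - t *: N).
Proof. by rewrite /bnd_line /= (touch_normal tM). Qed.

Lemma bnd_line_ge0 y t : dot y N = 0 -> bnd_line M x y t -> 0 <= t.
Proof.
move=> yN; rewrite bnd_lineE; case: tM => r0 [N1 NM] _ /NM.
rewrite (_ : _ - x = y - t *: N); last by apply/rowP => i; rewrite !mxE; ring.
by rewrite dotBl yN dotZl enorm1_dot// => ?; lra.
Qed.

Lemma bnd_line_lb y : dot y N = 0 -> has_lbound (bnd_line M x y).
Proof. by move=> yN; exists 0 => t; exact: bnd_line_ge0. Qed.

Lemma bnd_line_cap y : dot y N = 0 -> enorm y <= r ->
  bnd_line M x y (dot y y / r).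
Proof. by rewrite bnd_lineE; exact: touch_cap. Qed.

Lemma bnd_graph_ge0 y : dot y N = 0 -> enorm y <= r -> 0 <= bnd_graph M x y.
Proof.
move=> yN yr; apply: lb_le_inf; first by exists (dot y y / r);
  exact: bnd_line_cap.
by move=> t; exact: bnd_line_ge0.
Qed.

Lemma bnd_graph_le_line y t :
  dot y N = 0 -> bnd_line M x y t -> bnd_graph M x y <= t.
Proof. by move=> yN; apply: ge_inf; exact: bnd_line_lb. Qed.

Lemma bnd_graph_le y : dot y N = 0 -> enorm y <= r ->
  bnd_graph M x y <= dot y y / r.
Proof. by move=> yN yr; apply: bnd_graph_le_line => //;
  exact: bnd_line_cap. Qed.

(** A closed set contains the limits of its points along a line, so the infimum
    is attained. *)
Lemma bnd_graph_mem y : closed M -> dot y N = 0 -> enorm y <= r ->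
  M (x + y - bnd_graph M x y *: N).
Proof.
move=> cM yN yr; apply: contrapT => MN.
have [d d0 dM] := open_eball (closed_openC cM) MN.
have hi : has_inf (bnd_line M x y).
  by split; [exists (dot y y / r); exact: bnd_line_cap|exact: bnd_line_lb].
have [t Mt td] := inf_adherent d0 hi.
have gt := bnd_graph_le_line yN Mt.
move: Mt; rewrite bnd_lineE; apply: dM; rewrite /eball /=.
have -> : x + y - t *: N - (x + y - bnd_graph M x y *: N)
  = (bnd_graph M x y - t) *: N by apply/rowP => i; rewrite !mxE; ring.
case: tM => _ [N1 _] _; rewrite enormZ N1 mulr1 distrC ger0_norm ?subr_ge0//.
by rewrite lerBlDl ltW.
Qed.

Lemma bnd_graph_bnd y : closed M -> dot y N = 0 -> enorm y <= r ->
  bnd M (x + y - bnd_graph M x y *: N).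
Proof.
move=> cM yN yr; rewrite closed_bndE//; split; first exact: bnd_graph_mem.
move=> /interior_eballP[d d0 dM].
have : bnd_line M x y (bnd_graph M x y - d).
  rewrite bnd_lineE; apply: dM; rewrite /eball /=.
  rewrite (_ : _ - _ = d *: N); last by apply/rowP => i; rewrite !mxE; ring.
  by case: tM => _ [N1 _] _; rewrite enormZ N1 mulr1 gtr0_norm.
by move/(bnd_graph_le_line yN); rewrite lerBrDr gerDl leNgt d0.
Qed.

End line.
End touch.

(** * Bodies osculating to second order have the same curvatures *)

Section curvature.
Variables (R : realType) (n : nat).
Local Notation V := 'rV[R]_n.
Implicit Types (x y z u N : V) (t r : R) (M K L : set V).

Lemma mulmx_tr_dot k (x y : 'rV[R]_k) : (x *m y^T) 0 0 = dot x y.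
Proof. by rewrite mxE; apply: eq_bigr => i _; rewrite mxE. Qed.

Lemma nbhs0_enorm k r : 0 < r -> \forall z \near (0 : 'rV[R]_k), enorm z <= r.
Proof.
by move=> r0; apply/nbhs_eballP; exists r => // z; rewrite /eball /= subr0.
Qed.

Section frame.
Variables (k : nat) (E : 'M[R]_(k, n)) (N : V).
Hypotheses (EE : E *m E^T = 1%:M) (EN : E *m N^T = 0).

Lemma dot_frame (z w : 'rV[R]_k) : dot (z *m E) (w *m E) = dot z w.
Proof.
by rewrite -!mulmx_tr_dot trmx_mul mulmxA -(mulmxA z) EE mulmx1.
Qed.

Lemma enorm_frame (z : 'rV[R]_k) : enorm (z *m E) = enorm z.
Proof. by rewrite /enorm dot_frame. Qed.

Lemma dot_frame_normal (z : 'rV[R]_k) : dot (z *m E) N = 0.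
Proof. by rewrite -mulmx_tr_dot -mulmxA EN mulmx0 mxE. Qed.

End frame.

(** Second-order contact of the boundaries at [x]. *)
Definition osculate M M' x N := forall e, 0 < e -> exists2 d, 0 < d &
  forall y, dot y N = 0 -> enorm y <= d ->
    `|bnd_graph M x y - bnd_graph M' x y| <= e * dot y y.

Lemma osculate_sym M M' x N : osculate M M' x N -> osculate M' M x N.
Proof.
move=> H e /H[d d0 {}H]; exists d => // y yN yd; rewrite distrC; exact: H.
Qed.

Lemma is_principal_curvatures_osculate M M' x N r r' k :
  touch M x N r -> touch M' x N r' -> osculate M M' x N ->
  is_principal_curvatures M x k -> is_principal_curvatures M' x k.
Proof.
move=> tM tM' MM' [E [A [[EE EN] _ AT /eqoP oM kA]]]; exists E, A.
have EN' := EN; rewrite (touch_normal tM) in EN'.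
have r'0 : 0 < r' by case: tM'.
split=> //.
- by rewrite (touch_normal tM').
- apply: filterS (nbhs0_enorm _ r'0) => z zr;
  exists (dot (z *m E) (z *m E) / r').
  by apply: (bnd_line_cap tM');
    rewrite ?(dot_frame_normal EN')// (enorm_frame EE).
- apply/eqoP => e e0.
  have [d d0 H] := MM' _ (divr_gt0 e0 (ltr0n _ 2)).
  apply: filterS2 (nbhs0_enorm _ d0) (oM _ (divr_gt0 e0 (ltr0n _ 2))) => z zd
    aq.
  have := H (z *m E) (dot_frame_normal EN' z).
  rewrite (enorm_frame EE) (dot_frame EE) => /(_ zd).
  move: aq; rewrite /= (ger0_norm (dot_ge0 z)).
  set a := bnd_graph M _ _; set b := bnd_graph M' _ _; set q := _ / 2.
  move=> aq ab; have -> : b - q = (a - q) - (a - b) by ring.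
  rewrite (le_trans (ler_normB _ _))//.
  by move: ab aq; set s := dot z z => ab aq; lra.
Qed.

(** The two sets of admissible curvature vectors coincide, so [xget] chooses the
    same vector in both, or the default value in both. *)
Lemma principal_curvatures_osculate M M' x N r r' :
  touch M x N r -> touch M' x N r' -> osculate M M' x N ->
  principal_curvatures M x = principal_curvatures M' x.
Proof.
move=> tM tM' MM'; rewrite /principal_curvatures; congr xget.
apply/seteqP; split=> k;
  first exact: is_principal_curvatures_osculate tM tM' MM'.
by apply: is_principal_curvatures_osculate tM' tM _; exact: osculate_sym.
Qed.

Lemma W_density_osculate (p : R) m k M M' x N r r' :
  touch M x N r -> touch M' x N r' -> osculate M M' x N ->
  W_density p m k M x = W_density p m k M' x.
Proof.
move=> tM tM' MM'.
have pc := principal_curvatures_osculate tM tM' MM'.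
have mc j : mean_curvature M j x = mean_curvature M' j x.
  by rewrite /mean_curvature pc.
rewrite /W_density (touch_normal tM) (touch_normal tM') mc; congr (_ * _).
by apply: eq_bigr => i _; congr (_ * _); apply: eq_bigr => j _; rewrite mc.
Qed.

End curvature.

(** * Bounds on the curvatures and on the density *)

Section bounds.
Variables (R : realType) (n : nat).
Local Notation V := 'rV[R]_n.
Implicit Types (x y z u N : V) (t r : R) (M K L : set V).

(** The graph lies between the tangent hyperplane and the touching ball, and its
    expansion is exact up to [|z|^2] near 0, so half of the Hessian form takes
    values between [- |z|^2] and [(1 / r + 1) |z|^2]; test it on eigenvectors. *)
Lemma principal_curvature_le M x N r i : touch M x N r ->
  `|principal_curvatures M x 0 i| <= 2 / r + 2.
Proof.
move=> tM; have r0 : 0 < r by case: tM.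
have c0 : 0 <= 2 / r + 2 by rewrite addr_ge0// divr_ge0// ltW.
rewrite /principal_curvatures; case: xgetP => [k _|_];
  last by rewrite mxE normr0.
move=> [E [A [[EE EN] _ _ /eqoP oM kA]]].
rewrite (touch_normal tM) in EN.
have : eigenvalue A (k 0 i).
  rewrite eigenvalue_root_char kA /root horner_prod; rewrite prodf_seq_eq0;
    apply/hasP.
  by exists i; rewrite ?mem_index_enum//= hornerXsubC subrr.
move=> /eigenvalueP[v vA v0].
have [d d0 dM] := (nbhs_eballP _ _).1 (filterI (nbhs0_enorm _ r0) (oM _ ltr01)).
have nv0 : 0 < dot v v.
  rewrite lt_def dot_ge0 andbT; apply: contra v0 => /eqP vv.
  by apply/eqP/dot0_eq0; rewrite vv.
have nv : 0 < enorm v by rewrite /enorm sqrtr_gt0.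
have [s s0 sd] : exists2 s, 0 < s & s * enorm v = d.
  by exists (d / enorm v); rewrite ?divr_gt0 ?divfK ?gt_eqF.
have [|] := dM (s *: v).
  by rewrite /eball /= subr0 enormZ gtr0_norm// sd.
set w := dot v v in nv0 *.
have ss : dot (s *: v) (s *: v) = s * (s * w) by rewrite dotZl dotZr.
have sA : dot ((s *: v) *m A) (s *: v) = s * (k 0 i * (s * w)).
  by rewrite -scalemxAl vA !dotZl dotZr.
rewrite sA ss => zr.
have sr : enorm ((s *: v) *m E) <= r by rewrite (enorm_frame EE).
have sN := dot_frame_normal EN (s *: v).
have g0 := bnd_graph_ge0 tM sN sr; have := bnd_graph_le tM sN sr.
rewrite (dot_frame EE) ss; set g := bnd_graph _ _ _ in g0 *.
have sw : 0 < s * (s * w) by rewrite !mulr_gt0.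
rewrite mul1r (gtr0_norm sw) => gr; rewrite ler_distl => /andP[g1 g2].
have -> : `|k 0 i| = `|s * (k 0 i * (s * w))| / (s * (s * w)).
  rewrite (_ : s * (k 0 i * (s * w)) = k 0 i * (s * (s * w))); last by ring.
  by rewrite normrM (gtr0_norm sw) mulfK// gt_eqF.
rewrite ler_pdivrMr// ler_norml.
have -> : (2 / r + 2) * (s * (s * w)) = 2 * (s * (s * w) / r) + 2 * (s * (s *
  w)).
  by ring.
by move: gr g1 g2 g0; set a := _ / r; set b := s * (k 0 i * _);
  set e := s * (s * w) => ? ? ? ?; apply/andP; split; lra.
Qed.

Lemma mean_curvature_bounded r : 0 < r -> exists2 B, 1 <= B &
  forall M x N j, touch M x N r -> `|mean_curvature M j x| <= B.
Proof.
move=> r0; pose c := 1 + (2 / r + 2).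
have c1 : 1 <= c by rewrite /c lerDl addr_ge0// divr_ge0// ltW.
have c0 : 0 <= c by apply: le_trans c1.
exists (1 + \sum_(I : {set 'I_n.-1}) c ^+ n.-1).
  by rewrite lerDl sumr_ge0// => I _; rewrite exprn_ge0.
move=> M x N j tM; rewrite /mean_curvature normrM.
set S := (X in _ * `|X|); suff H : `|S| <= \sum_(I : {set 'I_n.-1}) c ^+ n.-1.
  have C1 : `|'C(n.-1, j)%:R^-1| <= 1 :> R.
    rewrite ger0_norm ?invr_ge0//.
    have [->|C0] := posnP 'C(n.-1, j); first by rewrite invr0.
    by rewrite invf_le1 ?ltr0n// ler1n.
  rewrite (le_trans (ler_pM _ _ C1 H))// mul1r lerDr.
  exact: ler01.
rewrite (le_trans (ler_norm_sum _ _ _))// big_mkcond; apply: ler_sum => I _.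
case: ifP => _; last by rewrite exprn_ge0.
rewrite normr_prod (le_trans (_ : _ <= \prod_(i in I) c)).
- by [].
- apply: ler_prod => i _;
  rewrite normr_ge0/= (le_trans (principal_curvature_le i tM))//.
  by rewrite lerDr.
- rewrite prodr_const ler_weXn2l//.
  by rewrite -[leqRHS]card_ord max_card.
Qed.

Lemma powR_bounded (a c d : R) : 0 < c -> exists2 B, 0 <= B &
  forall s, c <= s <= d -> `|s `^ a| <= B.
Proof.
move=> c0; exists (expR (`|a| * (`|ln c| + `|ln d|))); first exact: expR_ge0.
move=> s /andP[cs sd]; have s0 : 0 < s by exact: lt_le_trans cs.
rewrite ger0_norm ?powR_ge0// /powR gt_eqF// ler_expR.
rewrite (le_trans (ler_norm _))// normrM ler_wpM2l//.
have l1 : ln c <= ln s by rewrite ler_ln ?posrE.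
have l2 : ln s <= ln d by rewrite ler_ln ?posrE// (lt_le_trans s0).
rewrite ler_norml; apply/andP; split.
  rewrite lerNl (le_trans _ (ler_wpDr _ (lexx _)))//.
  by rewrite (le_trans (_ : _ <= - ln c)) ?lerN2// -normrN ler_norm.
by rewrite (le_trans l2)// (le_trans (ler_norm _))// lerDr.
Qed.

Lemma powR_le_max (a h B : R) : 0 <= a -> 1 <= B -> `|h| <= B ->
  `|h `^ a| <= B `^ a.
Proof.
move=> a0 B1 hB; rewrite ger0_norm ?powR_ge0//.
have B0 : 0 <= B by apply: le_trans B1.
have [h0|h0] := leP 0 h.
  by apply: ge0_ler_powR; rewrite ?nnegrE// (le_trans (ler_norm _)).
rewrite {1}/powR lt_eqF// ln0 ?(ltW h0)// mulr0 expR0.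
rewrite (_ : 1 = 1 `^ a); last by rewrite powR1.
by apply: ge0_ler_powR; rewrite ?nnegrE.
Qed.

(** The support function [<x, N>] stays between [r0] and [r1], which controls its
    possibly negative power. The curvatures may vanish, so the power of the
    Gauss curvature needs a nonnegative exponent. *)
Lemma W_density_bounded (p : R) m k M r r0 r1 :
  0 <= p / (n%:R + p) -> 0 < r -> 0 < r0 ->
  eball 0 r0 `<=` M -> M `<=` eball 0 r1 -> exists C,
  forall x N, touch M x N r -> `|W_density p m k M x| <= C.
Proof.
move=> q0 rp r0p r0M Mr1.
have [B B1 HB] := mean_curvature_bounded rp.
have [D D0 HD] := powR_bounded (m%:R - k%:R + n%:R * (1 - p) / (n%:R + p)) r1
  r0p.
exists (D * B `^ (p / (n%:R + p)) *
  \sum_(i : {ffun 'I_n.-1 -> 'I_m.+1} | (\sum_(j < n.-1) j.+1 * i j)%N == m)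
     `|steiner_coef p (fun j => i j)| *
     \prod_(j < n.-1) ('C(n.-1, j.+1)%:R ^+ i j * B ^+ i j)).
move=> x N tM; have Mx := touch_mem tM; have HBx j := HB _ _ _ j tM.
rewrite /W_density !normrM; apply: ler_pM; rewrite ?mulr_ge0//.
  apply: ler_pM => //; last exact: powR_le_max.
  apply: HD; rewrite (touch_normal tM); case: tM => _ [N1 NM] _.
  have := NM (r0 *: N); rewrite dotBl dotZl enorm1_dot// mulr1 subr_le0.
  move=> -> /=; last first.
    by apply: r0M; rewrite /eball /= subr0 enormZ N1 mulr1 gtr0_norm.
  rewrite (le_trans (dot_le_enorm _ _))// N1 mulr1.
  by have := Mr1 _ Mx; rewrite /eball /= subr0.
rewrite (le_trans (ler_norm_sum _ _ _))//; apply: ler_sum => i _.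
rewrite normrM ler_wpM2l// normr_prod; apply: ler_prod => j _.
rewrite normr_ge0 normrM !normrX /= ger0_norm// ler_wpM2l ?exprn_ge0//.
by rewrite lerXn2r ?nnegrE// (le_trans _ B1).
Qed.

End bounds.

(** * The density depends on the body only near the point *)

Section local.
Variables (R : realType) (n : nat).
Local Notation V := 'rV[R]_n.
Implicit Types (x y z u N : V) (t r : R) (M K L : set V).

Definition agree_near K M x d := forall z, eball x d z -> (K z <-> M z).

(** A support inequality near [x] extends to all of a convex set by contracting
    segments towards [x]. *)
Lemma touch_agree_near K M x N r d : @convex_set R V M -> 0 < d ->
  agree_near K M x d -> touch K x N r -> touch M x N (Num.min r (d / 2)).
Proof.
move=> cM d0 KM tK; have [r0 [N1 NK] bK] := tK.
have m0 : 0 < Num.min r (d / 2) by rewrite lt_min r0 divr_gt0.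
split=> //.
- split=> // y My; pose e := enorm (y - x); pose s := d / (d + e).
  have e0 : 0 <= e by exact: enorm_ge0.
  have de : 0 < d + e by rewrite ltr_wpDr.
  have s0 : 0 < s by rewrite divr_gt0.
  have xE : x + s *: (y - x) - x = s *: (y - x) by rewrite addrC addKr.
  have : K (x + s *: (y - x)).
    apply/KM.
      rewrite /eball /= xE enormZ gtr0_norm// -/e /s mulrAC ler_pdivrMr//.
      by rewrite ler_pM2l// lerDr ltW.
    apply: convex_lerp => //.
      by apply/KM; [apply: eball_center; exact: ltW|exact: touch_mem tK].
    by rewrite ltW//= ler_pdivrMr// mul1r lerDl.
  by move/NK; rewrite xE dotZl pmulr_rle0.
- move=> z zm; apply/KM; last by apply: bK; apply: sub_eball_touching zm;
  rewrite // ge_min lexx.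
  move: zm; rewrite /eball /= => zm.
  have -> : z - x = z - (x - Num.min r (d / 2) *: N) - Num.min r (d / 2) *: N.
    by apply/rowP => i; rewrite !mxE; ring.
  rewrite (le_trans (enormD _ _))// enormN enormZ N1 mulr1 gtr0_norm//.
  have : Num.min r (d / 2) <= d / 2 by rewrite ge_min lexx orbT.
  by move: zm; set a := enorm _; set b := Num.min _ _ => ? ?; lra.
Qed.

(** The touching ball keeps the graph below [|y|^2 / r], so the point of the graph
    over a small [y] is itself close to [x]. *)
Lemma bnd_graph_point_near M x N r y : touch M x N r -> dot y N = 0 ->
  enorm y <= r -> enorm (x + y - bnd_graph M x y *: N - x) <= 2 * enorm y.
Proof.
move=> tM yN yr; have [r0 [N1 _] _] := tM.
rewrite (_ : _ - x = y - bnd_graph M x y *: N); last first.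
  by apply/rowP => i; rewrite !mxE; ring.
rewrite (le_trans (enormD _ _))// enormN enormZ N1 mulr1.
rewrite ger0_norm ?(bnd_graph_ge0 tM)//.
have := bnd_graph_le tM yN yr; rewrite -sqr_enorm.
have : enorm y ^+ 2 / r <= enorm y.
  by rewrite ler_pdivrMr// expr2 ler_wpM2l// enorm_ge0.
lra.
Qed.

Lemma bnd_graph_le_agree K M x N r r' d y : closed K ->
  touch K x N r -> touch M x N r' -> agree_near K M x d ->
  dot y N = 0 -> enorm y <= r -> 2 * enorm y <= d ->
  bnd_graph M x y <= bnd_graph K x y.
Proof.
move=> cK tK tM KM yN yr yd; apply: (bnd_graph_le_line tM) => //.
rewrite (bnd_lineE tM); apply/KM; last exact: (bnd_graph_mem tK).
exact: le_trans (bnd_graph_point_near tK _ _) yd.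
Qed.

Lemma osculate_agree K M x N r r' d : closed K -> closed M -> 0 < d ->
  touch K x N r -> touch M x N r' -> agree_near K M x d -> osculate K M x N.
Proof.
move=> cK cM d0 tK tM KM e e0.
have r0 : 0 < r by case: tK.
have r'0 : 0 < r' by case: tM.
exists (Num.min (Num.min r r') (d / 2)).
  by rewrite !lt_min r0 r'0 divr_gt0.
move=> y yN; rewrite !le_min => /andP[/andP[yr yr'] yd].
have {}yd : 2 * enorm y <= d by move: yd; rewrite ler_pdivlMr// mulrC.
have MK : agree_near M K x d by move=> z /KM [? ?].
have -> : bnd_graph K x y = bnd_graph M x y.
  apply: le_anti; apply/andP; split.
    exact: bnd_graph_le_agree cM tM tK MK yN yr' yd.
  exact: bnd_graph_le_agree cK tK tM KM yN yr yd.
by rewrite subrr normr0 mulr_ge0 ?dot_ge0// ltW.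
Qed.

Lemma W_density_agree p m k K M x N r d :
  closed K -> closed M -> @convex_set R V M -> 0 < d ->
  touch K x N r -> agree_near K M x d ->
  W_density p m k K x = W_density p m k M x.
Proof.
move=> cK cM xM d0 tK KM; have tM := touch_agree_near xM d0 KM tK.
exact: W_density_osculate tK tM (osculate_agree cK cM d0 tK tM KM).
Qed.

End local.

(** * Common boundary points of two bodies with convex union *)

Section common.
Variables (R : realType) (n : nat).
Local Notation V := 'rV[R]_n.
Implicit Types (x y z u N : V) (t r : R) (M K L P U E : set V).

Lemma support_gt0 M x N : outer_unit_normal M x N -> M° 0 -> 0 < dot x N.
Proof.
move=> [N1 NM] /interior_eballP[d d0 dM].
have := NM (d *: N); rewrite dotBl dotZl enorm1_dot// mulr1 subr_le0.
move=> H; apply: (lt_le_trans d0 (H _)).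
by apply: dM; rewrite /eball /= subr0 enormZ N1 mulr1 gtr0_norm.
Qed.

Lemma touch_ray M x N r a : touch M x N r -> dot a N < 0 ->
  exists2 t, 0 < t & forall s, 0 <= s <= t -> M (x + s *: a).
Proof.
move=> [r0 [N1 _] bM] aN; have aa0 := dot_ge0 a.
exists (r * - (2 * dot a N) / (dot a a + 1)).
  by rewrite divr_gt0 ?ltr_wpDl// mulr_gt0//; lra.
move=> s /andP[s0]; rewrite ler_pdivlMr ?ltr_wpDl// => st.
apply: bM; rewrite /eball /=.
rewrite (_ : _ - _ = s *: a + r *: N); last by apply/rowP => i; rewrite !mxE;
  ring.
rewrite enorm_le; last exact: ltW.
rewrite !dotE (dotC N a) (enorm1_dot N1).
have : s * (s * (dot a a + 1) + r * (2 * dot a N)) <= 0.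
  by apply: mulr_ge0_le0 => //; lra.
nra.
Qed.

(** If [N] and [N'] were different, they could not be opposite, as the origin is
    interior to both bodies; so some [a] and [b] point into [K] and [L]
    respectively while [a + b] points out of both. The midpoint of a short
    segment from [x + t a] to [x + t b] then leaves the union. *)
Lemma common_normal K L x N N' r r' : @convex_set R V (K `|` L) ->
  K° 0 -> L° 0 -> touch K x N r -> touch L x N' r' -> N = N'.
Proof.
move=> cU K0 L0 tK tL.
have [_ oK _] := tK; have [_ oL _] := tL.
have xN := support_gt0 oK K0; have xN' := support_gt0 oL L0.
have [N1 NK] := oK; have [N'1 NL] := oL.
pose c := dot N N'.
have c1 : c <= 1 by rewrite (le_trans (dot_le_enorm _ _))// N1 N'1 mulr1.
have cN1 : -1 < c.
  rewrite ltNge; apply/negP => cN1.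
  have /dot0_eq0 NN : dot (N + N') (N + N') <= 0.
    by rewrite !dotE !enorm1_dot// (dotC N' N) -/c; lra.
  by have := dot0l x; rewrite -NN dotC dotDr; lra.
have [c_lt|] := ltP c 1; last first.
  move=> c1'; apply/eqP; rewrite -subr_eq0; apply/eqP; apply: dot0_eq0.
  by rewrite !dotE !enorm1_dot// (dotC N' N) -/c; lra.
pose l := (1 + c) / 2.
have aN : dot (N' - l *: N) N < 0.
  by rewrite !dotE enorm1_dot// (dotC N' N) -/c /l; lra.
have bN' : dot (N - l *: N') N' < 0.
  by rewrite !dotE enorm1_dot// -/c /l; lra.
have [t t0 Kt] := touch_ray tK aN; have [t' t'0 Lt] := touch_ray tL bN'.
pose s := Num.min t t'.
have s0 : 0 < s by rewrite lt_min t0 t'0.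
have /Kt Ka : 0 <= s <= t by rewrite ltW//= ge_min lexx.
have /Lt Lb : 0 <= s <= t' by rewrite ltW//= ge_min lexx orbT.
have := convex_lerp cU (or_introl Ka) (or_intror Lb).
move=> /(_ 2^-1); rewrite invr_ge0 invf_le1// ler0n ler1n => /(_ isT).
set z := x + _ + _.
have zx : z - x = (s * (1 - l) / 2) *: (N + N').
  by apply/rowP => i; rewrite /z !mxE; field.
have pos : 0 < s * (1 - l) / 2 * (1 + c).
  by rewrite mulr_gt0 ?divr_gt0 ?mulr_gt0// /l; lra.
case=> [/NK|/NL]; rewrite zx dotZl dotDl enorm1_dot// leNgt ?(dotC N' N) -/c
  ?pos//.
by rewrite (addrC c) pos.
Qed.

Lemma touch_between P U M x N r : P `<=` M -> M `<=` U ->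
  touch P x N r -> touch U x N r -> touch M x N r.
Proof.
move=> PM MU [r0 [N1 _] bP] [_ [_ NU] _]; split=> //.
  by split=> // y /MU/NU.
exact: subset_trans bP PM.
Qed.

Lemma le_bnd_graph M M' x N r r' y : M `<=` M' ->
  touch M x N r -> touch M' x N r' -> dot y N = 0 -> enorm y <= r ->
  bnd_graph M' x y <= bnd_graph M x y.
Proof.
move=> MM' tM tM' yN yr; apply: lb_le_inf.
  by exists (dot y y / r); exact: (bnd_line_cap tM).
move=> t; rewrite (bnd_lineE tM) => /MM' Mt.
by apply: (bnd_graph_le_line tM') => //; rewrite (bnd_lineE tM').
Qed.

(** The negation of porosity of [E] at [x] relative to [B]. *)
Definition relatively_dense_at (E B : set V) x := forall e, 0 < e ->
  exists2 d, 0 < d & forall q, B q -> enorm (q - x) <= d ->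
    exists2 z, E z & enorm (z - q) <= e * enorm (q - x).

(** Test the support inequality at [e] on the point of the ball touching at [x]
    whose outer normal is [u]. *)
Lemma touch_normal_continuous P U x N e u r : P `<=` U ->
  touch P x N r -> outer_unit_normal U e u -> r - enorm (x - e) <= r * dot N u.
Proof.
move=> PU [r0 [N1 _] bP] [u1 uU].
have := uU (x - r *: N + r *: u).
rewrite (_ : _ - e = (x - e) - r *: N + r *: u); last first.
  by apply/rowP => i; rewrite !mxE; ring.
rewrite !dotE (enorm1_dot u1) mulr1 => H.
have {}H : dot x u - dot e u - r * dot N u + r <= 0.
  by apply/H/PU/bP; rewrite /eball /= addrC addKr enormZ u1 mulr1 gtr0_norm.
have := dot_le_enorm (- (x - e)) u; rewrite u1 mulr1 enormN !dotE.
move: H; set a := enorm _; set b := r * _; lra.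
Qed.

(** Both graphs stay within [C h^2] of each other as soon as a point [e] of [E]
    lies at distance at most [h]: there the two bodies share a supporting
    hyperplane and contain the same ball of radius [r]. *)
Lemma osculate_dense P U E x N r : closed U -> P `<=` U ->
  (forall e, E e -> exists2 u, touch P e u r & touch U e u r) ->
  touch P x N r -> touch U x N r ->
  relatively_dense_at E (bnd U) x -> osculate P U x N.
Proof.
move=> cU PU HE tP tU dE e e0; have [r0 [N1 _] _] := tP.
(* With [h = 2 c |y|], moving down by [4 h ^ 2 / r] enters the ball touching at
   [z]; the constant 16 makes this displacement at most [e |y|^2]. *)
pose c := Num.min 1 (e * r / 16).
have c0 : 0 < c by rewrite lt_min ltr01 divr_gt0// mulr_gt0.
have c1 : c <= 1 by rewrite ge_min lexx.
have ce : 16 * c ^+ 2 / r <= e.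
  rewrite ler_pdivrMr// mulrC -ler_pdivlMr// expr2.
  by rewrite (le_trans (ler_piMl (ltW c0) c1))// ge_min lexx orbT.
have [d d0 Hd] := dE c c0.
exists (Num.min (r / 16) (d / 2)); first by rewrite lt_min !divr_gt0.
move=> y yN; rewrite le_min => /andP[yr16 yd].
have y0 := enorm_ge0 y.
have yr : enorm y <= r by lra.
pose q := x + y - bnd_graph U x y *: N.
have qU : bnd U q by exact: (bnd_graph_bnd tU).
have qx : enorm (q - x) <= 2 * enorm y by exact: (bnd_graph_point_near tU).
have [|z Ez zq] := Hd q qU; first by lra.
have [u tPz tUz] := HE z Ez; have [_ oUz _] := tUz.
pose h := 2 * c * enorm y; pose s := 4 * h ^+ 2 / r.
have h0 : 0 <= h by rewrite !mulr_ge0// ltW.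
have hr : h <= r / 8.
  rewrite /h -mulrA (le_trans (_ : _ <= 2 * enorm y))//; last by lra.
  by rewrite ler_pM2l// ler_piMl.
have qz : enorm (q - z) <= h.
  rewrite enormB (le_trans zq)// /h (mulrC 2) -mulrA.
  by rewrite (ler_wpM2l _ qx)// ltW.
have sr : s * r = 4 * h ^+ 2 by rewrite /s divfK// gt_eqF.
have s0 : 0 <= s by rewrite divr_ge0 ?mulr_ge0 ?sqr_ge0// ltW.
have sh : s <= h / 2.
  rewrite /s ler_pdivrMr// expr2; nra.
have Nu : 1 / 2 * r <= r * dot N u.
  have := touch_normal_continuous PU tP oUz.
  have := enorm_triangle x q z; rewrite (enormB x q) => H1 H2.
  apply: le_trans H2; move: (le_trans H1 (lerD qx qz)).
  by set a := enorm (x - z) => ?; lra.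
have Ps : P (q - s *: N).
  have [_ [u1 _] bPz] := tPz; apply: bPz; rewrite /eball /= enorm_le;
    last exact: ltW.
  rewrite (_ : _ - _ = (q - z) - s *: N + r *: u); last first.
    by apply/rowP => i; rewrite !mxE; ring.
  have w1 : dot (q - z) u <= 0.
    by have [_ H] := oUz; apply: H; case: qU;
      rewrite -(proj1 (closure_id U) cU).
  have w2 : - dot (q - z) N <= h.
    rewrite -dotNl (le_trans (dot_le_enorm _ _))// N1 mulr1 enormN.
    exact: qz.
  have w3 : dot (q - z) (q - z) <= h ^+ 2 by rewrite -enorm_le.
  move: (q - z) w1 w2 w3 => w w1 w2 w3.
  rewrite !(dotDl, dotDr, dotNl, dotNr, dotZl, dotZr) (enorm1_dot N1)
    (enorm1_dot u1).
  rewrite (dotC N w) (dotC u w) (dotC u N).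
  have k1 : s * (- dot w N) <= s * h by rewrite ler_wpM2l.
  have k2 : s * (1 / 2 * r) <= s * (r * dot N u) by rewrite ler_wpM2l.
  have k3 : r * dot w u <= 0 by rewrite pmulr_rle0.
  have k4 : s * s <= s * (h / 2) by rewrite ler_wpM2l.
  have k5 : s * h <= h / 2 * h by rewrite ler_wpM2r.
  nra.
have le1 : bnd_graph P x y <= bnd_graph U x y + s.
  apply: (bnd_graph_le_line tP) => //; rewrite (bnd_lineE tP).
  move: Ps; congr P; rewrite /q.
  by apply/rowP => i; rewrite !mxE; ring.
have le2 := le_bnd_graph PU tP tU yN yr.
rewrite ger0_norm ?subr_ge0// lerBlDl (le_trans le1)// lerD2l.
rewrite -sqr_enorm (le_trans (_ : _ <= 16 * c ^+ 2 / r * enorm y ^+ 2))//.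
  by rewrite le_eqVlt; apply/orP; left; apply/eqP; rewrite /s /h; field;
    rewrite gt_eqF.
by rewrite ler_wpM2r ?sqr_ge0.
Qed.

(** A larger body has a lower graph. *)
Lemma osculate_between P U M x N r : P `<=` M -> M `<=` U ->
  touch P x N r -> touch U x N r -> osculate P U x N -> osculate M U x N.
Proof.
move=> PM MU tP tU PU e /PU[d d0 H]; have r0 : 0 < r by case: tP.
have tM := touch_between PM MU tP tU.
exists (Num.min r d); first by rewrite lt_min r0.
move=> y yN; rewrite le_min => /andP[yr yd]; apply: le_trans (H y yN yd).
have a1 := le_bnd_graph MU tM tU yN yr; have a2 := le_bnd_graph PM tP tM yN yr.
by rewrite !ger0_norm ?subr_ge0 ?lerD2r// (le_trans a1).
Qed.

End common.

(** * Hausdorff measure is a metric outer measure *)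

Section metric_outer_measure.
Variables (R : realType) (n : nat).
Local Notation V := 'rV[R]_n.
Local Open Scope ereal_scope.
Implicit Types (A B C X : set V).

Definition separated (e : R) A B :=
  forall a b, A a -> B b -> (e <= enorm (a - b))%R.

Variable mu : {outer_measure set V -> \bar R}.
Hypothesis mu_metric : forall (e : R) A B, (0 < e)%R -> separated e A B ->
  mu A + mu B <= mu (A `|` B).

Section closed_measurable.
Variables (C X : set V).
Hypotheses (cC : closed C) (Xoo : mu X < +oo).

Let away k : set V := [set x | forall c, C c -> (k.+1%:R^-1 <= enorm (x -
  c))%R].
Let annulus k := X `&` (away k.+1 `\` away k).

Let away_homo j k : (j <= k)%N -> away j `<=` away k.
Proof.
by move=> jk x H c /H; apply: le_trans; rewrite lef_pV2 ?posrE// ler_nat.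
Qed.

Let bigcup_away : \bigcup_k away k = ~` C.
Proof.
apply/seteqP; split=> [x [k _ Hx] Cx|x].
  have := Hx x Cx; rewrite leNgt => /negP; apply.
  rewrite subrr (_ : (0 : V) = 0%R *: 0)%R ?scale0r//.
  by rewrite -(scale0r (0 : V)) enormZ normr0 mul0r invr_gt0.
move=> /(open_eball (closed_openC cC))[d d0 dC].
have [k _] := near_infty_natSinv_lt (PosNum d0).
move=> /(_ k (leqnn _)) /= kd.
exists k => // c Cc; rewrite leNgt; apply/negP => cx; apply: dC Cc.
by rewrite /eball /= enormB (le_trans (ltW cx))// ltW.
Qed.

(** Points beyond distance [1/(k+1)] of [C] and points within distance
    [1/(k+2)] of it stay away from each other by the triangle inequality. *)
Let separated_away k A B : A `<=` away k -> B `&` away k.+1 = set0 ->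
  exists2 e : R, (0 < e)%R & separated e A B.
Proof.
move=> Ak Bk; exists (k.+1%:R^-1 - k.+2%:R^-1)%R.
  by rewrite subr_gt0 ltf_pV2 ?posrE// ltr_nat.
move=> a b Aa Bb.
have /existsNP[c /not_implyP[Cc /negP]] : ~ away k.+1 b.
  by move=> Hb; suff : set0 b by []; rewrite -Bk.
rewrite -ltNge => bc; have := Ak a Aa c Cc; have := enorm_triangle a b c.
rewrite lerBlDr => H1 H2; rewrite (le_trans H2)// (le_trans H1)// lerD2l.
exact: ltW.
Qed.

(** Annuli of the same parity are pairwise separated, so their measures add up. *)
Let sum_annulus (b : bool) N : \sum_(i < N) mu (annulus (i.*2 + b)) <= mu X.
Proof.
suff H : \sum_(i < N) mu (annulus (i.*2 + b)) <=
    mu (\bigcup_(i in `I_N) annulus (i.*2 + b)).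
  apply: le_trans H _; apply: le_outer_measure => x [i _ []] //.
elim: N => [|N IH]; first by rewrite big_ord0 outer_measure_ge0.
rewrite big_ord_recr /= IIS bigcup_setU bigcup_set1.
apply: le_trans (leeD2r _ IH) _.
case: N {IH} => [|N].
  rewrite (_ : `I_0 = set0) ?bigcup_set0 ?outer_measure0 ?add0e ?set0U//.
  by apply/seteqP; split.
have [||e e0 se] := @separated_away (N.*2 + b).+1
  (\bigcup_(i in `I_N.+1) annulus (i.*2 + b)) (annulus (N.+1.*2 + b)).
- move=> x [i /= iN [_ [xi _]]]; apply: away_homo xi.
  by rewrite ltnS leq_add2r leq_double.
- rewrite -subset0 => x [[_ [_ xN]] xN']; apply: xN.
  by rewrite doubleS !addSn.
- exact: mu_metric e0 se.
Qed.

Let annulus_summable : \sum_(0 <= k <oo) mu (annulus k) < +oo.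
Proof.
apply: (@le_lt_trans _ _ (mu X + mu X)); last by rewrite lte_add_pinfty.
apply: lime_le; first by apply: is_cvg_nneseries => *; exact: outer_measure_ge0.
apply: nearW => N.
apply: (@le_trans _ _ (\sum_(0 <= k < N.*2) mu (annulus k))).
  apply: lee_sum_nneg_natr; first by move=> k _ _; exact: outer_measure_ge0.
  by rewrite -addnn leq_addr.
have -> : \sum_(0 <= k < N.*2) mu (annulus k) =
    \sum_(i < N) mu (annulus (i.*2 + false)) + \sum_(i < N) mu (annulus (i.*2 +
      true)).
  elim: N => [|N IH]; first by rewrite !big_ord0 big_nil adde0.
  rewrite doubleS !big_nat_recr//= IH !big_ord_recr /= addn0 addn1.
  by rewrite [RHS]addeACA -!addeA.
by apply: leeD; exact: sum_annulus.
Qed.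

(** The part of [X] outside [C] is exhausted by the points of [X] away from [C],
    up to tails of the convergent series of the annuli. *)
Lemma metric_closed_split : mu (X `&` C) + mu (X `&` ~` C) <= mu X.
Proof.
have tail0 := nneseries_tail_cvg annulus_summable
  (fun k _ => outer_measure_ge0 mu (annulus k)).
have Xfin : mu X \is a fin_num by rewrite ge0_fin_numE// outer_measure_ge0.
have bnd_k k : mu (X `&` C) + mu (X `&` ~` C) <=
    mu X + \sum_(k <= i <oo) mu (annulus i).
  have [e e0 se] : exists2 e : R, (0 < e)%R & separated e (X `&` away k) (X `&`
    C).
    apply: (@separated_away k) => [x []//|].
    rewrite -subset0 => x [[_ Cx]]; rewrite -/(away k.+1 x) => Ax.
    by have : (~` C) x by rewrite -bigcup_away; exists k.+1.
  apply: (@le_trans _ _ (mu (X `&` C) + (mu (X `&` away k) +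
      mu (\bigcup_(i in ~` `I_k) annulus i)))).
    rewrite leeD2l//; apply: le_trans (outer_measureU2 _ _ _).
    apply: le_outer_measure => x [Xx]; rewrite -bigcup_away => -[j _ xj].
    have [xk|xk] := pselect (away k x); first by left.
    right.
    have ex : exists i, `[< away i x >] by exists j; apply/asboolP.
    case: (ex_minnP ex) => -[|i] /asboolP xi imin.
      by case: xk; apply: away_homo xi.
    exists i; last by split=> //; split=> // /asboolP/imin; rewrite ltnn.
    by move=> /= ik; apply: xk; apply: away_homo xi.
  rewrite addeA; apply: leeD; last exact: outer_measure_sigma_subadditive_tail.
  rewrite addeC; apply: le_trans (mu_metric e0 se) _.
  by apply: le_outer_measure => x [] [].
have cv : (mu X + \sum_(k <= i <oo) mu (annulus i)) @[k --> \oo] --> mu X + 0.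
  by apply: cvgeD => //; [exact: fin_num_adde_defr|exact: cvg_cst].
rewrite adde0 in cv; apply: (cvge_ge _ cv); exact: nearW.
Qed.

End closed_measurable.

(** This is Caratheodory's criterion for metric outer measures. *)
Lemma metric_closed_caratheodory C : closed C -> mu.-caratheodory C.
Proof.
move=> cC; apply: le_caratheodory_measurable => X.
have [|Xoo] := leP +oo (mu X); first by rewrite leye_eq => /eqP ->; exact: leey.
exact: metric_closed_split.
Qed.

End metric_outer_measure.

Section hausdorff_metric.
Variables (R : realType) (n d : nat).
Local Notation V := 'rV[R]_n.
Local Open Scope ereal_scope.
Implicit Types (A B C X U : set V).

Lemma enorm_le_ediam U a b : U a -> U b -> (enorm (a - b))%:E <= ediam U.
Proof. by move=> Ua Ub; apply: ereal_sup_ubound; exists a => //; exists b. Qed.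

(** A covering set of small diameter cannot meet both [A] and [B], so a cover of
    the union splits into two covers without increasing the cost. *)
Lemma hausdorff_pre_separated (e : R) A B :
  (forall a b, A a -> B b -> (e < enorm (a - b))%R) ->
  hausdorff_pre d e A + hausdorff_pre d e B <= hausdorff_pre d e (A `|` B).
Proof.
move=> AB; apply: le_ereal_inf_tmp => _ [U [dU ABU] <-].
pose part (S : set V) i := if `[< (U i `&` S) !=set0 >] then U i else set0.
have cov S : S `<=` A `|` B ->
    hausdorff_pre d e S <= \sum_(i <oo) hausdorff_gauge d (part S i).
  move=> SAB; apply: ereal_inf_lbound; exists (part S) => //; split=> [i|x Sx].
    by rewrite /part; case: asboolP => // _; rewrite ediam0 leNye.
  have [i _ Uix] := ABU x (SAB _ Sx); exists i => //.
  by rewrite /part asboolT//; exists x.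
apply: le_trans (leeD (cov A (@subsetUl _ _ _)) (cov B (@subsetUr _ _ _))) _.
rewrite -nneseriesD; try by move=> *; exact: hausdorff_gauge_ge0.
apply: lee_nneseries => [i _ _|i _].
  by rewrite adde_ge0 ?hausdorff_gauge_ge0.
rewrite /part; case: asboolP => [[a [Ua Aa]]|_]; last first.
  rewrite hausdorff_gauge0 add0e; case: asboolP => // _.
  by rewrite hausdorff_gauge0 hausdorff_gauge_ge0.
case: asboolP => [[b [Ub Bb]]|_]; last by rewrite hausdorff_gauge0 adde0.
have := le_trans (enorm_le_ediam Ua Ub) (dU i).
by rewrite lee_fin leNgt AB.
Qed.

Lemma hausdorff_pre_anti (e e' : R) A : (e <= e')%R ->
  hausdorff_pre d e' A <= hausdorff_pre d e A.
Proof.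
move=> ee'; apply/ereal_inf_le_tmp => _ [U [dU AU] <-]; exists U => //;
  split=> // i.
by rewrite (le_trans (dU i))// lee_fin.
Qed.

Lemma hausdorff_metric (e : R) A B : (0 < e)%R -> separated e A B ->
  hausdorff d A + hausdorff d B <= hausdorff d (A `|` B).
Proof.
move=> e0 AB; have [|fin] := leP +oo (hausdorff d (A `|` B)).
  by rewrite leye_eq => /eqP ->; exact: leey.
have fS S : S `<=` A `|` B -> hausdorff d S \is a fin_num.
  move=> SAB; rewrite ge0_fin_numE ?hausdorff_ge0//.
  exact: le_lt_trans (le_hausdorff d SAB) fin.
have fB : hausdorff d B \is a fin_num by apply: fS; exact: subsetUr.
rewrite -leeBrDr//; apply: ge_ereal_sup => _ [e1 /= e10 <-].
have f1 : hausdorff_pre d e1 A \is a fin_num.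
  rewrite ge0_fin_numE ?hausdorff_pre_ge0//.
  apply: le_lt_trans (hausdorff_pre_le d _ e10) _.
  by rewrite -ge0_fin_numE ?hausdorff_ge0// fS//; exact: subsetUl.
rewrite leeBrDr// -leeBrDl//; apply: ge_ereal_sup => _ [e2 /= e20 <-].
rewrite leeBrDl//.
pose e' := Num.min (Num.min e1 e2) (e / 2)%R.
have e'0 : (0 < e')%R by rewrite !lt_min e10 e20 divr_gt0.
apply: le_trans (hausdorff_pre_le d (A `|` B) e'0).
apply: le_trans (hausdorff_pre_separated _).
  by apply: leeD; apply: hausdorff_pre_anti; rewrite !ge_min lexx ?orbT.
move=> a b Aa Bb; apply: lt_le_trans (AB a b Aa Bb).
by rewrite gt_min orbC ltr_pdivrMr// ltr_pMr// ltr1n.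
Qed.

Lemma hausdorff_closed_measurable C : closed C ->
  (hausdorff d : {outer_measure set V -> \bar R}).-caratheodory C.
Proof. by apply: metric_closed_caratheodory; exact: hausdorff_metric. Qed.

End hausdorff_metric.

(** * Integrals of arbitrary functions as lower integrals *)

Section lower_integral.
Context d (T : measurableType d) (R : realType).
Variable mu : {measure set T -> \bar R}.
Local Open Scope ereal_scope.
Import HBNNSimple.
Implicit Types (A B D Z : set T) (f g : T -> \bar R).

Lemma simple_le_integral D f (h : {nnsfun T >-> R}) :
  (forall x, D x -> 0 <= f x) -> (forall x, (h x)%:E <= (f \_ D) x) ->
  \int[mu]_x (h x)%:E <= \int[mu]_(x in D) f x.
Proof.
move=> f0 hf; rewrite (ge0_integralE _ f0) integralT_nnsfun.
by apply: ereal_sup_ubound; exists h.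
Qed.

Lemma integral_le_simple D f c : (forall x, D x -> 0 <= f x) ->
  (forall h : {nnsfun T >-> R}, (forall x, (h x)%:E <= (f \_ D) x) ->
    \int[mu]_x (h x)%:E <= c) ->
  \int[mu]_(x in D) f x <= c.
Proof.
move=> f0 H; rewrite (ge0_integralE _ f0).
by apply: ge_ereal_sup => _ [h hf <-]; rewrite -integralT_nnsfun; exact: H.
Qed.

Lemma lower_integral_le D D' f g : D `<=` D' -> (forall x, D x -> 0 <= f x) ->
  (forall x, D' x -> 0 <= g x) -> (forall x, D x -> f x <= g x) ->
  \int[mu]_(x in D) f x <= \int[mu]_(x in D') g x.
Proof.
move=> DD' f0 g0 fg; apply: integral_le_simple => // h hf.
apply: simple_le_integral => // x; apply: le_trans (hf x) _.
rewrite /patch; case: ifPn => [|_]; rewrite ?inE.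
  by move=> Dx; rewrite ifT ?inE; [exact: fg|exact: DD'].
by case: ifPn => // /[!inE]; exact: g0.
Qed.

Let simple_integral D f (h : {nnsfun T >-> R}) : measurable D ->
  (forall x, (h x)%:E <= (f \_ D) x) ->
  \int[mu]_x (h x)%:E = \int[mu]_(x in D) (h x)%:E.
Proof.
move=> mD hf; rewrite [RHS]integral_mkcond; apply: eq_integral => x _.
rewrite /patch; case: ifPn => // Dx; apply/eqP; rewrite eq_le.
have := hf x; rewrite /patch (negbTE Dx) => -> /=.
by rewrite lee_fin; exact: fun_ge0.
Qed.

(** The integral is a supremum over simple functions, and a simple function below
    [f] on [A `|` B] is the sum of its restrictions to [A] and [B], which are
    simple as [A] and [B] are measurable. *)
Lemma lower_integral_setU A B f : measurable A -> measurable B ->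
  [disjoint A & B] -> (forall x, (A `|` B) x -> 0 <= f x) ->
  \int[mu]_(x in A `|` B) f x =
  \int[mu]_(x in A) f x + \int[mu]_(x in B) f x.
Proof.
move=> mA mB AB f0.
have fA x : A x -> 0 <= f x by move=> Ax; apply: f0; left.
have fB x : B x -> 0 <= f x by move=> Bx; apply: f0; right.
apply/eqP; rewrite eq_le; apply/andP; split.
  apply: integral_le_simple => // h hf.
  rewrite (simple_integral (measurableU _ _ mA mB) hf).
  rewrite ge0_integral_setU//; last 2 first.
  - by apply/measurable_realfun.measurable_EFinP; exact: measurable_funTS.
  - by move=> x _; rewrite lee_fin; exact: fun_ge0.
  have le D : D `<=` A `|` B -> (forall x, D x -> 0 <= f x) -> measurable D ->
      \int[mu]_(x in D) (h x)%:E <= \int[mu]_(x in D) f x.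
    move=> DAB fD mD; apply: lower_integral_le => // x Dx.
      by rewrite lee_fin; exact: fun_ge0.
    by have := hf x; rewrite /patch ifT// inE; exact: DAB.
  by apply: leeD; apply: le.
have [|fin] := leP +oo (\int[mu]_(x in A `|` B) f x).
  by rewrite leye_eq => /eqP ->; exact: leey.
set I := \int[mu]_(x in A `|` B) f x in fin *.
have I0 : 0 <= I by exact: integral_ge0.
have fin_le x : 0 <= x -> x <= I -> x \is a fin_num.
  by move=> x0 xI; rewrite ge0_fin_numE// (le_lt_trans xI).
have finB : \int[mu]_(x in B) f x \is a fin_num.
  by apply: fin_le; [exact: integral_ge0|apply: lower_integral_le].
rewrite -leeBrDr//; apply: integral_le_simple => // h1 h1f.
have int_ge0 (h : {nnsfun T >-> R}) : 0 <= \int[mu]_x (h x)%:E.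
  by apply: integral_ge0 => x _; rewrite lee_fin; exact: fun_ge0.
have fin1 : \int[mu]_x (h1 x)%:E \is a fin_num.
  apply: fin_le => //; apply: le_trans (simple_le_integral fA h1f) _.
  exact: lower_integral_le.
rewrite leeBrDr// -leeBrDl//; apply: integral_le_simple => // h2 h2f.
rewrite leeBrDl// -ge0_integralD//; first last.
- exact/measurable_realfun.measurable_EFinP.
- by move=> x _; rewrite lee_fin; exact: fun_ge0.
- exact/measurable_realfun.measurable_EFinP.
- by move=> x _; rewrite lee_fin; exact: fun_ge0.
have := @simple_le_integral (A `|` B) f (add_nnsfun h1 h2) f0; apply => x.
have := h1f x; have := h2f x; rewrite /patch in_setU /= EFinD.
have [Ax|Ax] := boolP (x \in A); have [Bx|Bx] := boolP (x \in B) => /= b a.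
- by move: Ax Bx; rewrite !inE => Ax Bx; have /disj_setPS/(_ x) := AB; case.
- by rewrite -[leRHS]adde0; exact: leeD.
- by rewrite -[leRHS]add0e; exact: leeD.
- by rewrite -[leRHS]add0e; exact: leeD.
Qed.

Lemma lower_integral_null Z f : measurable Z -> mu Z = 0 ->
  (forall x, Z x -> 0 <= f x) -> \int[mu]_(x in Z) f x = 0.
Proof.
move=> mZ Z0 f0; apply/eqP; rewrite eq_le integral_ge0// andbT.
apply: integral_le_simple => // h hf; rewrite (simple_integral mZ hf).
rewrite null_set_integral//.
by apply/measurable_realfun.measurable_EFinP; exact: measurable_funTS.
Qed.

Lemma integral_ae_eq_lower D Z f g : measurable D -> measurable Z ->
  Z `<=` D -> mu Z = 0 -> (forall x, D x -> ~ Z x -> f x = g x) ->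
  \int[mu]_(x in D) f x = \int[mu]_(x in D) g x.
Proof.
move=> mD mZ ZD Z0 fg.
have split f0 : (forall x, 0 <= f0 x) ->
    \int[mu]_(x in D) f0 x = \int[mu]_(x in D `\` Z) f0 x.
  move=> f00; rewrite -[in LHS](setDUK ZD) setUC lower_integral_setU//.
  - by rewrite [X in _ + X]lower_integral_null ?adde0.
  - exact: measurableD.
  - by rewrite disj_set2E setDKI.
rewrite integralE [RHS]integralE.
rewrite !split; try by move=> x; rewrite ?funepos_ge0 ?funeneg_ge0.
congr (_ - _); apply: eq_integral => x; rewrite inE => -[Dx Zx].
  by rewrite !funeposE fg.
by rewrite !funenegE fg.
Qed.

End lower_integral.

Definition bounded_on (T : Type) (R : realType) (D : set T) (f : T -> R) :=
  exists C, forall x, D x -> `|f x| <= C.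

Section lower_Rintegral.
Context d (T : measurableType d) (R : realType).
Variable mu : {measure set T -> \bar R}.
Implicit Types (A B D : set T) (f g : T -> R).

Let finite_part D (f : T -> \bar R) C : measurable D -> (mu D < +oo)%E ->
  (forall x, D x -> (0 <= f x <= C%:E)%E) ->
  (\int[mu]_(x in D) f x)%E \is a fin_num.
Proof.
move=> mD Doo fC.
rewrite ge0_fin_numE; last by apply: integral_ge0 => x /fC/andP[].
apply: (@le_lt_trans _ _ (\int[mu]_(x in D) (cst `|C|%:E) x)%E).
  apply: lower_integral_le => // x Dx; have /andP[f0 fC'] := fC x Dx;
    first exact: f0.
  by rewrite /= lee_fin.
  by rewrite /= (le_trans fC')// lee_fin ler_norm.
by rewrite integral_cst//; apply: lte_mul_pinfty => //; rewrite lee_fin.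
Qed.

Lemma lower_Rintegral_setU A B f : measurable A -> measurable B ->
  (mu A < +oo)%E -> (mu B < +oo)%E -> [disjoint A & B] ->
  bounded_on A f -> bounded_on B f ->
  \int[mu]_(x in A `|` B) f x = \int[mu]_(x in A) f x + \int[mu]_(x in B) f x.
Proof.
move=> mA mB Aoo Boo AB [C HC] [C' HC']; rewrite /Rintegral.
have fp D E : measurable D -> (mu D < +oo)%E ->
    (forall x, D x -> `|f x| <= E) ->
    (\int[mu]_(x in D) ((EFin \o f)^\+ x))%E \is a fin_num /\
    (\int[mu]_(x in D) ((EFin \o f)^\- x))%E \is a fin_num.
  move=> mD Doo HE; split; apply: (@finite_part _ _ E) => // x Dx.
    rewrite funepos_ge0 funeposE /= ge_max !lee_fin.
    by rewrite !(le_trans _ (HE x Dx))// ler_norm.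
  rewrite funeneg_ge0 funenegE /= ge_max !lee_fin.
  by rewrite !(le_trans _ (HE x Dx))// -normrN ler_norm.
have [pA nA] := fp A C mA Aoo HC; have [pB nB] := fp B C' mB Boo HC'.
rewrite integralE [in RHS]integralE [X in _ = _ + fine X]integralE.
rewrite !lower_integral_setU//.
rewrite -(fineK pA) -(fineK nA) -(fineK pB) -(fineK nB) /=; ring.
Qed.

Lemma lower_Rintegral_ae_eq D Z f g : measurable D -> measurable Z ->
  Z `<=` D -> mu Z = 0%E -> (forall x, D x -> ~ Z x -> f x = g x) ->
  \int[mu]_(x in D) f x = \int[mu]_(x in D) g x.
Proof.
move=> mD mZ ZD Z0 fg; congr fine; apply: integral_ae_eq_lower mZ ZD Z0 _ => //.
by move=> x Dx Zx; rewrite fg.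
Qed.

End lower_Rintegral.

(** * Dyadic cells and porous sets *)

Section outer_measure_finite.
Context (T : Type) (R : realType) (mu : {outer_measure set T -> \bar R}).
Local Open Scope ereal_scope.

Lemma outer_measure_fin_subadditive (I : finType) (F : I -> set T) X :
  X `<=` \bigcup_i F i -> mu X <= \sum_(i : I) mu (F i).
Proof.
move=> XF.
pose G k := if insub k is Some j then F (enum_val (j : 'I_#|I|)) else set0.
have GE (j : 'I_#|I|) : G j = F (enum_val j) by rewrite /G valK.
apply: (@le_trans _ _ (mu (\big[setU/set0]_(j < #|I|) G j))).
  apply: le_outer_measure => x /XF[i _ Fx]; rewrite -bigcup_mkord.
  exists (enum_rank i) => /=; first by rewrite ltn_ord.
  by rewrite GE enum_rankK.
apply: le_trans (outer_measure_subadditive _ _ _) _.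
rewrite (reindex_onto (@enum_rank I) (@enum_val I predT)) /=; last first.
  by move=> j _; rewrite enum_valK.
rewrite [leLHS](eq_bigl xpredT) => [|i]; last by rewrite enum_rankK eqxx.
by apply: lee_sum => i _; rewrite GE enum_rankK.
Qed.

End outer_measure_finite.

Section dyadic.
Variables (R : realType) (T : Type) (d : nat) (a : T -> 'I_d -> R).
Implicit Types (k q : nat) (w : 'I_d -> int) (P : set T).

(** [a] gives the coordinates of the points; the cells of level [k] are the
    preimages of the dyadic cubes of side [2 ^ - k]. *)
Definition address k x : 'I_d -> int := fun j => Num.floor (2 ^+ k * a x j).

Definition cell k w : set T := [set x | address k x = w].

Definition subaddress q w (u : {ffun 'I_d -> 'I_(2 ^ q)}) : 'I_d -> int :=
  fun j => w j * 2 ^+ q + (u j : nat)%:Z.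

Definition cell_volume k : R := ((2 ^ k) ^ d)%:R^-1.

Lemma cell_volume_gt0 k : 0 < cell_volume k.
Proof. by rewrite invr_gt0 ltr0n !expn_gt0. Qed.

Lemma sum_cell_volume c k q :
  \sum_(u : {ffun 'I_d -> 'I_(2 ^ q)}) c * cell_volume (k + q) =
  c * cell_volume k :> R.
Proof.
rewrite sumr_const card_ffun !card_ord -mulr_natr -mulrA; congr (_ * _).
by rewrite /cell_volume expnD expnMn natrM invfM mulfVK// pnatr_eq0 -lt0n
  !expn_gt0.
Qed.

Lemma address_sub k q x : exists u : {ffun 'I_d -> 'I_(2 ^ q)},
  address (k + q) x = subaddress (address k x) u.
Proof.
have H j : exists u : 'I_(2 ^ q),
    address (k + q) x j = address k x j * 2 ^+ q + (u : nat)%:Z.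
  rewrite /address exprD; set y := 2 ^+ k * a x j.
  rewrite mulrAC -/y; set z := Num.floor y; set z' := Num.floor (y * _).
  have q0 : 0 < 2 ^+ q :> R by rewrite exprn_gt0.
  have E : (z * 2 ^+ q)%:~R = z%:~R * 2 ^+ q :> R by rewrite intrM rmorphXn.
  have lo : z * 2 ^+ q <= z'.
    by rewrite floor_ge_int E ler_pM2r// floor_le.
  have hi : z' < z * 2 ^+ q + 2 ^+ q.
    rewrite floor_lt_int intrD E rmorphXn /= -[X in _ + X]mul1r -mulrDl.
    by rewrite ltr_pM2r// -intrD1 floorD1_gt.
  have uq : (absz (z' - z * 2 ^+ q)%R < 2 ^ q)%N.
    rewrite -ltz_nat gez0_abs ?subr_ge0// ltrBlDl (lt_le_trans hi)//.
    by rewrite lerD2l -natrX natz.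
  exists (Ordinal uq) => /=.
  by rewrite gez0_abs ?subr_ge0// addrC subrK.
have /choice[u Hu] := H.
exists [ffun j => u j]; apply/funext => j.
by rewrite Hu /subaddress ffunE.
Qed.

End dyadic.

Section porous_null.
Variables (R : realType) (T : Type) (d : nat) (a : T -> 'I_d -> R).
Variable mu : {outer_measure set T -> \bar R}.
Variables (P : set T) (q : nat).
Implicit Types (w : 'I_d -> int) (k : nat).
Local Notation cell := (cell a).
Local Notation address := (address a).
Local Notation v := (@cell_volume R d).

Definition has_hole w k := exists u : {ffun 'I_d -> 'I_(2 ^ q)},
  P `&` cell (k + q) (subaddress w u) = set0.

Lemma cell_split k w r :
  P `&` cell k w `<=` \bigcup_(u : {ffun 'I_d -> 'I_(2 ^ r)})
    (P `&` cell (k + r) (subaddress w u)).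
Proof.
move=> x [Px <-]; have [u xu] := address_sub a k r x.
by exists u => //; split.
Qed.

Section improve.
Variable c : R.
Hypothesis mu_cell : forall k w, (mu (P `&` cell k w) <= (c * v k)%:E)%E.
Let c' := (1 - v q) * c.

Let mu_hole k w : has_hole w k -> (mu (P `&` cell k w) <= (c' * v k)%:E)%E.
Proof.
move=> [u0 u0P].
apply: le_trans (outer_measure_fin_subadditive mu (@cell_split k w q)) _.
rewrite (bigD1 u0)//= u0P outer_measure0 add0e.
apply: (@le_trans _ _ (\sum_(u : {ffun 'I_d -> 'I_(2 ^ q)} | u != u0)
    (c * v (k + q))%:E)%E); first by apply: lee_sum => u _; exact: mu_cell.
have := sum_cell_volume d c k q; rewrite (bigD1 u0)//= => /eqP.
rewrite eq_sym addrC -subr_eq => /eqP E.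
rewrite sumEFin -E lee_fin /c' le_eqVlt; apply/orP; left; apply/eqP.
rewrite (_ : v (k + q) = v q * v k); first by ring.
by rewrite /cell_volume expnD expnMn natrM invfM mulrC.
Qed.

(** The stopping-time decomposition: a cell is no longer subdivided once it has a
    hole, and [j] counts the subdivisions. *)
Fixpoint first_hit j k w : set T :=
  if `[< has_hole w k >] then (if j is 0 then P `&` cell k w else set0)
  else if j is j'.+1 then
    \bigcup_(u : {ffun 'I_d -> 'I_(2 ^ 1)}) first_hit j' (k + 1) (subaddress w
      u)
  else set0.

(** A stopped cell contributes [c'] times its volume; [c'] is [c] reduced by the
    proportion of the hole. *)
Fixpoint hit_bound j k w : R :=
  if `[< has_hole w k >] then (if j is 0 then c' * v k else 0)
  else if j is j'.+1 then
    \sum_(u : {ffun 'I_d -> 'I_(2 ^ 1)}) hit_bound j' (k + 1) (subaddress w u)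
  else 0.

Let mu_first_hit j k w : (mu (first_hit j k w) <= (hit_bound j k w)%:E)%E.
Proof.
elim: j k w => [|j IH] k w /=; case: asboolP => hw; rewrite ?outer_measure0//.
  exact: mu_hole.
apply: le_trans (outer_measure_fin_subadditive mu (@subset_refl _ _)) _.
by rewrite -sumEFin; apply: lee_sum => u _; exact: IH.
Qed.

Hypothesis c0 : 0 <= c'.

(** Stopped cells are disjoint, so their volumes sum up to at most that of the
    initial cell; the induction replaces this by additivity over one
    subdivision. *)
Let sum_hit_bound J k w : \sum_(j < J) hit_bound j k w <= c' * v k.
Proof.
elim: J k w => [|J IH] k w.
  by rewrite big_ord0 mulr_ge0// ltW// cell_volume_gt0.
rewrite big_ord_recl /=; case: asboolP => hw.
  by rewrite big1 ?addr0// => i _.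
rewrite add0r exchange_big /= -(sum_cell_volume d c' k 1).
by apply: ler_sum => u _; exact: IH.
Qed.

Hypothesis porous : forall x, P x -> forall k0, exists2 k,
  (k0 <= k)%N & has_hole (address k x) k.

(** The partial sums of [hit_bound] do not control the points that are never
    stopped, but there are none. *)
Let first_hit_cover k w : P `&` cell k w `<=` \bigcup_j first_hit j k w.
Proof.
move=> x [Px xw]; have [k' kk' hk'] := porous Px k.
have [m k'E] : exists m, k' = (k + m)%N by exists (k' - k)%N; rewrite subnKC.
rewrite k'E {k' kk' k'E} in hk'.
elim: m k w xw hk' => [|m IH] k w xw hk.
  by exists 0%N => //=; rewrite asboolT//; rewrite addn0 xw in hk.
have [hw|hw] := pselect (has_hole w k).
  by exists 0%N => //=; rewrite asboolT.
have [u xu] := address_sub a k 1 x; rewrite xw in xu.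
have [|j _ xj] := IH (k + 1)%N _ xu; first by rewrite -addnA add1n.
by exists j.+1 => //=; rewrite asboolF//; exists u.
Qed.

Lemma mu_cell_improve k w : (mu (P `&` cell k w) <= (c' * v k)%:E)%E.
Proof.
apply: le_trans (le_outer_measure mu _ _ (@first_hit_cover k w)) _.
apply: le_trans (outer_measure_sigma_subadditive mu _) _.
apply: lime_le; first by apply: is_cvg_nneseries => *; exact: outer_measure_ge0.
apply: nearW => N; rewrite big_mkord.
apply: (@le_trans _ _ (\sum_(j < N) (hit_bound j k w)%:E)%E).
  by apply: lee_sum => j _; exact: mu_first_hit.
by rewrite sumEFin lee_fin; exact: sum_hit_bound.
Qed.

End improve.

(** If the measure of every cell is at most [c] times its volume, discarding the
    holes improves [c] by the factor [1 - 2 ^ - (q d)]; iterate. *)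
Lemma porous_null c : 0 <= c ->
  (forall k w, (mu (P `&` cell k w) <= (c * v k)%:E)%E) ->
  (forall x, P x -> forall k0, exists2 k,
    (k0 <= k)%N & has_hole (address k x) k) ->
  mu P = 0%E.
Proof.
move=> c0 Hc porous.
have vq1 : 0 <= 1 - v q < 1.
  rewrite subr_ge0 gtrBl cell_volume_gt0 andbT invf_le1 ?ltr0n ?expn_gt0//.
  by rewrite ler1n !expn_gt0.
have /andP[vq0 vql] := vq1.
have iter m k w : (mu (P `&` cell k w) <= ((1 - v q) ^+ m * c * v k)%:E)%E.
  elim: m k w => [|m IH] k w; first by rewrite expr0 mul1r.
  rewrite exprS -[_ * _ * c]mulrA; apply: mu_cell_improve => //.
  by apply: mulr_ge0 => //; apply: mulr_ge0 => //; exact: exprn_ge0.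
have cell0 w : mu (P `&` cell 0 w) = 0%E.
  apply/eqP; rewrite eq_le outer_measure_ge0 andbT.
  have cv : ((1 - v q) ^+ m * c * v 0%N)%:E @[m --> \oo] --> 0%E.
    apply: cvg_EFin; first exact: nearW.
    rewrite (_ : fine \o _ = fun m => (1 - v q) ^+ m * (c * v 0%N)); last first.
      by apply/funext => m /=; rewrite mulrA.
    rewrite -(mul0r (c * v 0%N)); apply: cvgM; last exact: cvg_cst.
    by apply: cvg_expr; rewrite ger0_norm.
  by apply: (cvge_ge _ cv); apply: nearW => m; exact: iter.
pose F m := if unpickle m is Some w then P `&` cell 0 (fun_of_fin (w : {ffun
  'I_d -> int}))
  else set0.
apply/eqP; rewrite eq_le outer_measure_ge0 andbT.
apply: (@le_trans _ _ (mu (\bigcup_m F m))).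
  apply: le_outer_measure => x Px;
    exists (pickle [ffun j => address 0 x j]) => //.
  rewrite /F pickleK; split=> //; apply/funext => j; by rewrite ffunE.
apply: le_trans (outer_measure_sigma_subadditive mu _) _.
rewrite eseries0// => m _ _; rewrite /F; case: unpickle => [w|//].
exact: cell0.
Qed.

End porous_null.

(** * Hausdorff measure of dyadic cells *)

Section hausdorff_cell.
Variables (R : realType) (n d : nat).
Local Notation V := 'rV[R]_n.
Variable a : V -> 'I_d -> R.

HB.instance Definition _ (delta : R) := isOuterMeasure.Build R V
  (hausdorff_pre d delta) (@hausdorff_pre0 R n d delta)
  (hausdorff_pre_ge0 d delta) (@le_hausdorff_pre R n d delta)
  (hausdorff_pre_sigma_subadditive d delta).

Lemma hausdorff_pre_le_gauge delta (A : set V) :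
  (ediam A <= delta%:E)%E -> (hausdorff_pre d delta A <= hausdorff_gauge d A)%E.
Proof.
move=> dA; pose U i : set V := if i is 0%N then A else set0.
apply: (@le_trans _ _ (\sum_(i <oo) hausdorff_gauge d (U i))%E).
  apply: ereal_inf_lbound; exists U => //; split=> [[|i] //=|x Ax];
    last by exists 0%N.
  by rewrite ediam0 leNye.
rewrite nneseries_recl//=; last by move=> *; exact: hausdorff_gauge_ge0.
rewrite [X in (_ + X)%E](_ : _ = 0%E) ?adde0//.
by rewrite eseries_cond/= eseries0// => -[|i] //= _ _; rewrite hausdorff_gauge0.
Qed.

Variables (P : set V) (D : R).
Hypothesis D0 : 0 <= D.
Hypothesis diamP : forall k w x y, (P `&` cell a k w) x -> (P `&` cell a k w) y
  ->
  enorm (x - y) <= D / 2 ^+ k.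

Let ediam_cell k w : (ediam (P `&` cell a k w) <= (D / 2 ^+ k)%:E)%E.
Proof.
by apply: ge_ereal_sup => _ [x Px [y Py <-]]; rewrite lee_fin;
  exact: diamP Px Py.
Qed.

Let gauge_cell k w : (hausdorff_gauge d (P `&` cell a k w) <=
  (ball_volume R d * (D / 2) ^+ d * cell_volume R d k)%:E)%E.
Proof.
rewrite /hausdorff_gauge; case: eqP => [_|/eqP/set0P PC].
  by rewrite lee_fin !mulr_ge0 ?ball_volume_ge0 ?exprn_ge0 ?divr_ge0// ltW
    ?cell_volume_gt0.
rewrite lee_fin -mulrA ler_wpM2l ?ball_volume_ge0//.
have -> : (D / 2) ^+ d * cell_volume R d k = (D / 2 ^+ k / 2) ^+ d.
  by rewrite /cell_volume !natrX -exprVn -exprMn mulrAC.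
have fin : ediam (P `&` cell a k w) \is a fin_num.
  by rewrite ge0_fin_numE ?ediam_ge0// (le_lt_trans (ediam_cell _ _)) ?ltry.
rewrite lerXn2r ?nnegrE ?divr_ge0 ?exprn_ge0 ?fine_ge0 ?ediam_ge0//.
by rewrite ler_wpM2r// -lee_fin fineK.
Qed.

(** Cover the cell by its descendants of a deep level: their number times the
    [d]-th power of their diameter does not depend on the level. *)
Lemma hausdorff_cell_le k w : (hausdorff d (P `&` cell a k w) <=
  (ball_volume R d * (D / 2) ^+ d * cell_volume R d k)%:E)%E.
Proof.
apply: ge_ereal_sup => _ [e /= e0 <-].
have [q qe] : exists q, D / 2 ^+ (k + q) <= e.
  pose b := Num.truncn (D / e); exists b.+1.
  rewrite ler_pdivrMr ?exprn_gt0// mulrC -ler_pdivrMr//.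
  have /truncn_itv/andP[_ /ltW/le_trans] : 0 <= D / e by rewrite divr_ge0// ltW.
  apply; rewrite -natrX ler_nat ltnW// (leq_trans (ltn_expl b.+1 (isT : 1 <
    2)%N))//.
  by rewrite leq_exp2l// leq_addl.
apply: le_trans (outer_measure_fin_subadditive (hausdorff_pre d e) (@cell_split
  _ _ _ a P k w q)) _.
rewrite -(sum_cell_volume d _ k q) -sumEFin; apply: lee_sum => u _.
apply: le_trans (hausdorff_pre_le_gauge _) (gauge_cell _ _).
by rewrite (le_trans (ediam_cell _ _))// lee_fin.
Qed.

End hausdorff_cell.

(** * Central projection charts of the boundary of a convex body *)

Section shifted_grid.
Variable R : realType.

Lemma expn2_mod3 k : ~~ (3 %| 2 ^ k)%N.
Proof. by rewrite Euclid_dvdX//= negb_and. Qed.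

(** Points closer than a sixth of the mesh that are separated both by the grid
    and by its translate by [1 / 3] would make [2 ^ k] a multiple of 3. *)
Lemma floor_shift_third k (y z : R) : `|y - z| <= 6^-1 ->
  Num.floor y = Num.floor z \/
  Num.floor (y + 2 ^+ k / 3) = Num.floor (z + 2 ^+ k / 3).
Proof.
wlog yz : y z / y <= z.
  move=> H; have [yz|/ltW zy] := leP y z; first exact: H.
  by rewrite distrC => /(H z y zy)[E|E]; [left|right].
move=> yz6; apply: contrapT => /not_orP[n1 n2].
have sep (t t' : R) : t <= t' -> Num.floor t <> Num.floor t' ->
    t < (Num.floor t')%:~R <= t'.
  move=> tt' ne; rewrite floor_le andbT -floor_lt_int lt_neqAle le_floor//
    andbT.
  exact/eqP.
have /andP[a1 a2] := sep _ _ yz n1.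
have /andP[b1 b2] := sep (y + 2 ^+ k / 3) (z + 2 ^+ k / 3) (lerD yz (lexx _))
  n2.
set a := Num.floor z in a1 a2; set b := Num.floor _ in b1 b2.
move: yz6; rewrite distrC ger0_norm ?subr_ge0// => yz6.
have [k1 k2] : 2 ^+ k - 1 < 3 * (b%:~R - a%:~R) :> R /\ 3 * (b%:~R - a%:~R) < 2
  ^+ k + 1 :> R.
  by move: a1 a2 b1 b2 yz6; set p := 2 ^+ k => *; split; lra.
have E : 3 * (b - a) = 2 ^+ k.
  have lt (z1 z2 : int) : z1%:~R < z2%:~R + 1 :> R -> z1 <= z2.
    by rewrite -intrD1 ltr_int ltzD1.
  have e1 : (3 * (b - a))%:~R = 3 * (b%:~R - a%:~R) :> R by rewrite intrM intrB.
  have e2 : (2 ^+ k)%:~R = 2 ^+ k :> R by rewrite rmorphXn.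
  by apply/eqP; rewrite eq_le !lt// e1 e2// -ltrBlDr.
have := expn2_mod3 k; apply/negP; rewrite negbK.
have -> : (2 ^ k)%N = absz (3 * (b - a)) by rewrite E abszX.
by rewrite abszM dvdn_mulr.
Qed.

Lemma dyadic_scale (t : R) k0 : 0 < t -> t <= (2 ^+ k0)^-1 ->
  exists2 k, (k0 <= k)%N & t <= (2 ^+ k)^-1 < 2 * t.
Proof.
move=> t0 tk0.
have ex : exists N, (2 ^+ N)^-1 < t.
  exists (Num.truncn t^-1).+1; rewrite invf_plt ?posrE ?exprn_gt0//.
  have /truncn_itv/andP[_ /lt_le_trans] : 0 <= t^-1 by rewrite invr_ge0 ltW.
  by apply; rewrite -natrX ler_nat ltnW// ltn_expl.
case: (ex_minnP ex) => N Nt Nmin.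
have kN : (k0 < N)%N.
  rewrite ltnNge; apply/negP => Nk; move: Nt; rewrite ltNge (le_trans tk0)//.
  by rewrite lef_pV2 ?posrE ?exprn_gt0// ler_eXn2l// ltr1n.
case: N => // N in Nt Nmin kN *; exists N => //.
rewrite leNgt; apply/andP; split.
  by apply/negP => /Nmin; rewrite ltnn.
move: Nt; rewrite exprS invfM => Nt; lra.
Qed.

End shifted_grid.

Section chart.
Variables (R : realType) (n : nat).
Local Notation V := 'rV[R]_n.
Variables (U : set V) (r0 r1 : R).
Hypotheses (cU : @convex_set R V U) (r0p : 0 < r0)
  (Ur0 : forall z, `|z| <= r0 -> U z) (Ur1 : forall z, U z -> `|z| <= r1).
Local Notation B := (U `\` U°).

(** The convex hull of a point of [U] and a ball around the origin contains a ball
    around every point of the segment from the origin to it, save the end. *)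
Lemma cone_interior x y l : U x -> 0 <= l < 1 ->
  `|y - l *: x| < (1 - l) * r0 -> U° y.
Proof.
move=> Ux /andP[l0 l1] yl; apply/interior_eballP.
exists ((1 - l) * r0 - `|y - l *: x|); first by rewrite subr_gt0.
move=> z; rewrite /eball /= => zy; have l1' : 0 < 1 - l by rewrite subr_gt0.
pose w := (1 - l)^-1 *: (z - l *: x).
have Uw : U w.
  apply: Ur0; rewrite normrZ gtr0_norm ?invr_gt0// mulrC ler_pdivrMr// mulrC.
  have -> : z - l *: x = (z - y) + (y - l *: x) by rewrite addrA subrK.
  rewrite (le_trans (ler_normD _ _))// -lerBrDr.
  by rewrite (le_trans (norm_le_enorm _)).
have -> : z = w + l *: (x - w).
  by apply/rowP => i; rewrite !mxE; field; rewrite gt_eqF.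
by apply: convex_lerp => //; rewrite l0 ltW.
Qed.

Lemma bnd_norm_ge x : B x -> r0 <= `|x|.
Proof.
move=> [Ux Ix]; rewrite leNgt; apply/negP => xr; apply: Ix.
by apply: (@cone_interior 0 _ 0); rewrite ?lexx ?ltr01 ?scale0r ?subr0 ?mul1r//;
  apply: Ur0; rewrite normr0 ltW.
Qed.

Let r1_ge0 x : U x -> 0 <= r1. Proof. by move/Ur1; apply: le_trans. Qed.

Variables (i : 'I_n) (s : R).
Hypothesis s2 : s ^+ 2 = 1.

Definition height (x : V) := s * x 0 i.

(** Central projection from the origin to the hyperplane [s x_i = 1]. It is
    bi-Lipschitz on the part of the boundary where [height] is bounded below,
    and the inverse inequality is stated without constructing the inverse. *)
Definition chart (x : V) (j : 'I_n.-1) := x 0 (lift i j) / height x.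

Let s1 : `|s| = 1.
Proof. by apply/eqP; rewrite -(@eqrXn2 _ 2)// real_normK ?num_real// s2 expr1n.
  Qed.

Lemma height_le x : `|height x| <= `|x|.
Proof. by rewrite normrM s1 mul1r norm_coord. Qed.

Lemma heightB x y : height (x - y) = height x - height y.
Proof. by rewrite /height !mxE mulrBr. Qed.

Definition chart_inv_const := r1 * (r1 / r0 + 1).

(** If [y] lay much lower than [x] over a nearby point of the chart, it would be
    interior to the convex hull of [x] and a ball around the origin. *)
Let chart_inv_lipschitz_le x y e : U x -> B y -> 0 < height y ->
  height y <= height x -> 0 <= e ->
  (forall j, `|chart x j - chart y j| <= e) -> `|x - y| <= chart_inv_const * e.
Proof.
move=> Ux By hy hyx e0 xy.
have hx : 0 < height x by apply: lt_le_trans hyx.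
pose l := height y / height x.
have l0 : 0 <= l by rewrite divr_ge0// ltW.
have l1 : l <= 1 by rewrite ler_pdivrMr// mul1r.
have r10 := r1_ge0 Ux.
have Dle : `|y - l *: x| <= height y * e.
  apply: norm_le_coord; first by rewrite mulr_ge0// ltW.
  move=> k; rewrite !mxE; case: (unliftP i k) => [j ->|->].
    rewrite (_ : _ - _ = height y * (chart y j - chart x j)).
      by rewrite normrM gtr0_norm// (ler_wpM2l (ltW hy))// distrC.
    by rewrite /chart /l; field; rewrite !gt_eqF.
  have E (z : V) : z 0 i = s * height z by rewrite /height mulrA -expr2 s2
    mul1r.
  have -> : y 0 i - l * x 0 i = 0.
    by rewrite (E x) (E y) /l; field; rewrite gt_eqF.
  by rewrite normr0 mulr_ge0// ltW.
have lD : (1 - l) * r0 <= `|y - l *: x|.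
  have [l1'|l1'] := ltP l 1;
    last by rewrite (le_trans _ (normr_ge0 _))// mulr_le0_ge0 ?subr_le0// ltW.
  rewrite leNgt; apply/negP => D; case: By => _; apply.
  by apply: cone_interior D => //; rewrite l0.
have -> : x - y = (1 - l) *: x - (y - l *: x).
  by apply/rowP => k; rewrite !mxE; ring.
rewrite (le_trans (ler_normB _ _))// normrZ ger0_norm ?subr_ge0//.
have hr : height y <= r1.
  by rewrite (le_trans (ler_norm _))// (le_trans (height_le _))// Ur1//;
    case: By.
apply: (@le_trans _ _ ((height y * e) * (r1 / r0 + 1))); last first.
  rewrite /chart_inv_const mulrAC ler_wpM2r// ler_wpM2r// addr_ge0// divr_ge0//.
  exact: ltW.
rewrite mulrDr mulr1; apply: lerD => //.
apply: (@le_trans _ _ ((1 - l) * r1)).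
  by rewrite ler_wpM2l ?subr_ge0// Ur1.
rewrite mulrA mulrAC ler_wpM2r// ler_pdivlMr//.
exact: le_trans lD Dle.
Qed.

Lemma chart_inv_lipschitz x y e : B x -> B y -> 0 < height x -> 0 < height y ->
  0 <= e -> (forall j, `|chart x j - chart y j| <= e) ->
  `|x - y| <= chart_inv_const * e.
Proof.
move=> Bx By hx hy e0 xy; have [h|/ltW h] := leP (height y) (height x).
  by apply: chart_inv_lipschitz_le => //; case: Bx.
rewrite distrC; apply: chart_inv_lipschitz_le => //; first by case: By.
by move=> j; rewrite distrC.
Qed.

Lemma chart_lipschitz x y b j : 0 < b -> b <= height x -> b <= height y ->
  `|y| <= r1 -> `|chart x j - chart y j| <= (b^-1 + r1 / b ^+ 2) * `|x - y|.
Proof.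
move=> b0 bx by_ yr; have hx := lt_le_trans b0 bx;
  have hy := lt_le_trans b0 by_.
have -> : chart x j - chart y j = (x - y) 0 (lift i j) / height x +
    y 0 (lift i j) * (height y - height x) / (height x * height y).
  by rewrite /chart !mxE; field; rewrite !gt_eqF.
rewrite (le_trans (ler_normD _ _))// mulrDl; apply: lerD.
  rewrite normrM mulrC normfV (gtr0_norm hx).
  by apply: ler_pM => //; rewrite ?invr_ge0 ?norm_coord ?lef_pV2 ?posrE// ltW.
rewrite !normrM normfV -heightB (gtr0_norm (mulr_gt0 hx hy)) mulrAC.
apply: ler_pM => //; rewrite ?mulr_ge0 ?invr_ge0//.
- by rewrite ltW// mulr_gt0.
- apply: ler_pM => //; rewrite ?invr_ge0 ?(le_trans (norm_coord _ _))//.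
    by rewrite ltW// mulr_gt0.
  rewrite lef_pV2 ?posrE ?exprn_gt0// ?expr2; last exact: mulr_gt0.
  by apply: ler_pM => //; exact: ltW.
- by rewrite (le_trans (height_le _))// distrC.
Qed.

End chart.

Section porous_boundary.
Variables (R : realType) (n : nat).
Local Notation V := 'rV[R]_n.
Variables (U : set V) (r0 r1 : R).
Hypotheses (cU : @convex_set R V U) (r0p : 0 < r0)
  (Ur0 : forall z, `|z| <= r0 -> U z) (Ur1 : forall z, U z -> `|z| <= r1).
Local Notation B := (U `\` U°).

Section one_chart.
Variables (i : 'I_n) (s : R).
Hypothesis s2 : s ^+ 2 = 1.

(** The part of the boundary projecting to the face [s x_i = 1] of the cube. *)
Definition face : set V := [set x | B x /\ height i s x = `|x|].

Definition shifted_chart (t : 'I_n.-1 -> R) (x : V) j := chart i s x j + t j.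

Lemma address_dist k (a : V -> 'I_n.-1 -> R) x y j :
  address a k x = address a k y -> `|a x j - a y j| <= (2 ^+ k)^-1.
Proof.
move=> /(congr1 (fun f => f j)); rewrite /address => E.
have p0 : 0 < 2 ^+ k :> R by rewrite exprn_gt0.
rewrite -[leRHS]mul1r ler_pdivlMr// -[X in _ * X](gtr0_norm p0) -normrM mulrBl.
have := floor_itv (2 ^+ k * a x j); rewrite E intrD mulr1z.
have := floor_itv (2 ^+ k * a y j); rewrite intrD mulr1z.
set z := (_%:~R : R) => /andP[z1 z2] /andP[z3 z4].
by rewrite ler_norml !(mulrC _ (2 ^+ k)); apply/andP; split; lra.
Qed.

Let height_gt0 x : face x -> 0 < height i s x.
Proof.
by move=> [Bx ->]; apply: lt_le_trans (bnd_norm_ge cU r0p Ur0 Bx).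
Qed.

Let C := chart_inv_const r0 r1.

Lemma face_cell_diam t P k w x y : P `<=` face ->
  (P `&` cell (shifted_chart t) k w) x -> (P `&` cell (shifted_chart t) k w) y
    ->
  enorm (x - y) <= n%:R * C / 2 ^+ k.
Proof.
move=> Pf [/Pf fx xw] [/Pf fy yw].
rewrite (le_trans (enorm_le_norm _))// -mulrA ler_wpM2l//.
apply: (chart_inv_lipschitz cU r0p Ur0 Ur1 (i := i) s2); rewrite ?height_gt0//.
- by case: fx.
- by case: fy.
move=> j; have := @address_dist k (shifted_chart t) x y j.
by rewrite /shifted_chart xw yw opprD addrACA subrr addr0; exact.
Qed.

Hypothesis r10 : 0 <= r1.

Lemma chart_inv_const_ge0 : 0 <= C.
Proof. by rewrite mulr_ge0// addr_ge0// divr_ge0// ltW. Qed.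

Let C0 : 0 <= n%:R * C. Proof. by rewrite mulr_ge0// chart_inv_const_ge0. Qed.

Lemma face_cell_finite t P k w : P `<=` face ->
  (hausdorff n.-1 (P `&` cell (shifted_chart t) k w) <=
    (ball_volume R n.-1 * (n%:R * C / 2) ^+ n.-1 * cell_volume R n.-1 k)%:E)%E.
Proof.
move=> Pf; apply: hausdorff_cell_le => // k' w' x y Px Py.
exact: face_cell_diam Pf Px Py.
Qed.

Lemma face_finite : (hausdorff n.-1 face < +oo)%E.
Proof.
pose W (u : {ffun 'I_n.-1 -> 'I_3}) : 'I_n.-1 -> int := fun j => (u j : nat)%:Z
  - 1.
pose a := shifted_chart (fun=> 0).
apply: (@le_lt_trans _ _ (\sum_(u : {ffun 'I_n.-1 -> 'I_3})
    hausdorff n.-1 (face `&` cell a 0 (W u)))%E).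
  apply: (outer_measure_fin_subadditive (hausdorff n.-1)) => x fx.
  have H j : exists u : 'I_3, address a 0 x j = (u : nat)%:Z - 1.
    rewrite /address expr0 mul1r /a /shifted_chart addr0;
      set c := chart i s x j.
    have c1 : `|c| <= 1.
      have hx := height_gt0 fx; have [_ hE] := fx.
      by rewrite normrM normfV (gtr0_norm hx) ler_pdivrMr// mul1r hE norm_coord.
    have lo : -1 <= Num.floor c by rewrite floor_ge_int; move: c1;
      rewrite ler_norml => /andP[].
    have hi : Num.floor c < 2.
      by rewrite floor_lt_int; apply: (@le_lt_trans _ _ 1);
        [exact: le_trans (ler_norm _) c1|rewrite (ltr_int R 1 2)].
    have u3 : (absz (Num.floor c + 1)%R < 3)%N.
      by rewrite -ltz_nat gez0_abs -?lerBlDr ?sub0r// -ltrBrDr.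
    by exists (Ordinal u3); rewrite /= gez0_abs ?addrK// -lerBlDr sub0r.
  have /choice[u Hu] := H; exists [ffun j => u j] => //; split=> //.
  by apply/funext => j; rewrite Hu /W ffunE.
apply: lte_sum_pinfty => u _.
by apply: le_lt_trans (face_cell_finite (fun=> 0) 0 (W u) (@subset_refl _
  face)) _; rewrite ltry.
Qed.

Variables (E : set V) (c : R).
Hypothesis c0 : 0 < c.

(** Porosity of [E] relative to the boundary, with constant [c]. *)
Definition porous : set V := [set x | [/\ E x, face x & forall e, 0 < e ->
  exists q, [/\ B q, enorm (q - x) <= e &
    forall z, E z -> c * enorm (q - x) < enorm (z - q)]]].

Let b := r0 / 2.
Let L := b^-1 + r1 / b ^+ 2.

Let b0 : 0 < b. Proof. by rewrite divr_gt0. Qed.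

Let L0 : 0 < L.
Proof. by rewrite ltr_wpDr ?invr_gt0// divr_ge0// exprn_ge0// ltW. Qed.

(** Coordinatewise translates of the dyadic grid by 0 or [1 / 3]. *)
Let third (t : {ffun 'I_n.-1 -> bool}) : 'I_n.-1 -> R := fun j => (t j)%:R / 3.

(** So many subdivisions turn a cell of the size of the distance of a hole into
    cells that fit into the hole. *)
Let depth := (Num.truncn (12 * L * (n%:R * C) / c)).+1.

Let depthP : 12 * L * (n%:R * C) / 2 ^+ depth <= c.
Proof.
rewrite ler_pdivrMr ?exprn_gt0// -ler_pdivrMl// mulrC.
have /truncn_itv/andP[_ /ltW/le_trans] : 0 <= 12 * L * (n%:R * C) / c.
  by rewrite divr_ge0 ?(ltW c0)// mulr_ge0// mulr_ge0// ltW.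
by apply; rewrite -natrX ler_nat ltnW// ltn_expl.
Qed.

Let hole_at t k x := has_hole (shifted_chart (third t)) porous depth
  (address (shifted_chart (third t)) k x) k.

(** A point [x] of porosity and the center [q] of a nearby hole may lie in distant
    dyadic cells although they are close. By [floor_shift_third], some translate
    of the grid puts them in a common cell of size comparable to their distance,
    and a subcell around [q] fits into the hole. *)
Lemma porous_has_hole x k0 : porous x -> exists t k, (k0 <= k)%N /\
  hole_at t k x.
Proof.
move=> [Ex fx px]; have [Bx hx] := fx.
pose e := Num.min (r0 / 2) ((2 ^+ k0)^-1 / (6 * L)).
have e0 : 0 < e by rewrite lt_min !divr_gt0// ?invr_gt0 ?exprn_gt0// mulr_gt0.
have [q [Bq qxe Eq]] := px e e0.
set rho := enorm (q - x) in qxe Eq.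
have rho0 : 0 < rho.
  rewrite lt_def enorm_ge0 andbT; apply/eqP => rho0.
  by have := Eq x Ex; rewrite enormB -/rho rho0 mulr0 ltxx.
have [r02 rk] : rho <= r0 / 2 /\ 6 * L * rho <= (2 ^+ k0)^-1.
  move: qxe; rewrite le_min => /andP[? ]; split=> //.
  by rewrite mulrC -ler_pdivlMr// mulr_gt0.
have [|k k0k /andP[k1 k2]] := dyadic_scale _ rk; first by rewrite !mulr_gt0.
have rx := bnd_norm_ge cU r0p Ur0 Bx.
have qx : `|q - x| <= rho by exact: norm_le_enorm.
have hq : b <= height i s q.
  have : `|height i s q - height i s x| <= rho.
    by rewrite -heightB (le_trans (height_le _ s2 _)).
  by rewrite hx ler_distl => /andP[+ _]; apply: le_trans; rewrite /b; lra.
have hxb : b <= height i s x by rewrite hx (le_trans _ rx)// /b; lra.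
have chart_xq j : `|chart i s x j - chart i s q j| <= L * rho.
  have qr : `|q| <= r1 by apply: Ur1; case: Bq.
  rewrite (le_trans (chart_lipschitz s2 j b0 hxb hq qr))//.
  by rewrite ler_wpM2l ?(ltW L0)// distrC.
have shift j : exists t : bool,
    Num.floor (2 ^+ k * (chart i s x j + t%:R / 3)) =
    Num.floor (2 ^+ k * (chart i s q j + t%:R / 3)).
  have p0 : 0 < 2 ^+ k :> R by rewrite exprn_gt0.
  have [||H] := @floor_shift_third R k (2 ^+ k * chart i s x j) (2 ^+ k * chart
    i s q j).
  - rewrite -mulrBr normrM (gtr0_norm p0) mulrC -ler_pdivlMr//.
    rewrite (le_trans (chart_xq j))//; move: k1.
    by set p := (2 ^+ k)^-1 => k1; lra.
  - by exists false; rewrite /= mul0r !addr0.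
  - by exists true; rewrite /= mulr1n !mulrDr mul1r.
have /choice[t Ht] := shift.
pose tt := [ffun j => t j]; pose a := shifted_chart (third tt).
have axq : address a k x = address a k q.
  by apply/funext => j; rewrite /address /a /shifted_chart /third ffunE.
exists tt, k; split=> //.
have [u qu] := address_sub a k depth q.
exists u; rewrite -/a axq -subset0 => x' [[Ex' fx' _] x'u].
have x'q : address a (k + depth) x' = address a (k + depth) q by rewrite qu.
have := Eq x' Ex'; apply/negP; rewrite -leNgt.
have hx' := height_gt0 fx'.
have D : `|x' - q| <= C * (2 ^+ (k + depth))^-1.
  apply: (chart_inv_lipschitz cU r0p Ur0 Ur1 (i := i) s2) => //.
  - by case: fx'.
  - exact: lt_le_trans hq.
  move=> j; have := address_dist j x'q.
  by rewrite /a /shifted_chart opprD addrACA subrr addr0.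
rewrite (le_trans (enorm_le_norm _))// (le_trans (ler_wpM2l _ D))//.
rewrite exprD invfM.
apply: (@le_trans _ _ (12 * L * (n%:R * C) / 2 ^+ depth * rho)); last first.
  by rewrite ler_wpM2r// ltW.
have -> : 12 * L * (n%:R * C) / 2 ^+ depth * rho =
    (n%:R * C) * ((2 * (6 * L * rho)) / 2 ^+ depth) by ring.
rewrite [leLHS]mulrA ler_wpM2l// ler_wpM2r ?invr_ge0 ?exprn_ge0//.
exact: ltW.
Qed.

(** There are finitely many translates of the grid, so one of them works at
    arbitrarily small scales. *)
Lemma porous_hausdorff0 : hausdorff n.-1 porous = 0%E.
Proof.
pose P t := [set x | porous x /\ forall k0, exists2 k, (k0 <= k)%N &
  hole_at t k x].
have P0 t : hausdorff n.-1 (P t) = 0%E.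
  apply: (@porous_null _ _ _ (shifted_chart (third t)) (hausdorff n.-1) (P t)
    depth
    (ball_volume R n.-1 * (n%:R * C / 2) ^+ n.-1)).
  - by rewrite mulr_ge0 ?ball_volume_ge0// exprn_ge0// divr_ge0.
  - by move=> k w; apply: face_cell_finite => x [[_ fx _] _].
  - move=> x [_ Hx] k0; have [k k0k [u Hu]] := Hx k0; exists k => //; exists u.
    by rewrite -subset0 => z [[pz _] zu]; rewrite -Hu.
apply/eqP; rewrite eq_le hausdorff_ge0 andbT.
rewrite (_ : 0%E = (\sum_(t : {ffun 'I_n.-1 -> bool}) hausdorff n.-1 (P t))%E);
  last first.
  by rewrite big1.
apply: (outer_measure_fin_subadditive (hausdorff n.-1)) => x px.
apply: contrapT => nP.
have : forall t : {ffun 'I_n.-1 -> bool}, exists k0, forall k, (k0 <= k)%N ->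
    ~ hole_at t k x.
  move=> t; apply: contrapT => H; apply: nP; exists t => //; split=> // k0.
  apply: contrapT => H'; apply: H; exists k0 => k k0k hk; apply: H';
    by exists k.
move=> /choice[f Hf].
have [t [k [kf hk]]] := porous_has_hole (\max_t f t) px.
by apply: (Hf t k) => //; apply: leq_trans kf; exact: leq_bigmax.
Qed.

End one_chart.
End porous_boundary.

Section boundary_density.
Variables (R : realType) (n : nat).
Local Notation V := 'rV[R]_n.
Variables (U : set V) (r0 r1 : R).
Hypotheses (cU : @convex_set R V U) (r0p : 0 < r0)
  (Ur0 : forall z, `|z| <= r0 -> U z) (Ur1 : forall z, U z -> `|z| <= r1).
Local Notation B := (U `\` U°).

Let r1_ge0 : 0 <= r1.
Proof.
by rewrite -(normr0 V); apply: Ur1; apply: Ur0; rewrite normr0 ltW.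
Qed.

Let sgn (b : bool) : R := (-1) ^+ b.

Let sgn2 b : sgn b ^+ 2 = 1. Proof. by rewrite /sgn sqrr_sign. Qed.

Lemma bnd_face x : B x -> exists ib : 'I_n * bool, face U ib.1 (sgn ib.2) x.
Proof.
move=> Bx; have := lt_le_trans r0p (bnd_norm_ge cU r0p Ur0 Bx).
rewrite lt_def => /andP[/mx_norm_neq0[[j i] /= xi] _].
exists (i, x 0 i < 0); split=> //=.
rewrite [RHS]/Num.norm /= xi (ord1 j) /height /sgn.
by rewrite normrEsign.
Qed.

Lemma bnd_hausdorff_finite : (hausdorff n.-1 B < +oo)%E.
Proof.
apply: (@le_lt_trans _ _
    (\sum_(ib : 'I_n * bool) hausdorff n.-1 (face U ib.1 (sgn ib.2)))%E).
  apply: (outer_measure_fin_subadditive (hausdorff n.-1)) => x /bnd_face[ib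
    xib].
  by exists ib.
apply: lte_sum_pinfty => ib _.
exact: (face_finite cU r0p Ur0 Ur1 ib.1 (sgn2 ib.2) r1_ge0).
Qed.

(** This plays the role of Lebesgue's density theorem. A point failing relative
    density is porous on some face with some constant [1 / (m + 1)], and there
    are countably many such choices. *)
Lemma not_dense_hausdorff0 E : E `<=` B ->
  hausdorff n.-1 [set x | E x /\ ~ relatively_dense_at E B x] = 0%E.
Proof.
move=> EB; apply/eqP; rewrite eq_le hausdorff_ge0 andbT.
pose F m := \bigcup_(ib : 'I_n * bool) porous U ib.1 (sgn ib.2) E m.+1%:R^-1.
apply: (@le_trans _ _ (hausdorff n.-1 (\bigcup_m F m))).
  apply: le_hausdorff => x [Ex /existsNP[e /not_implyP[e0 nd]]].
  pose m := Num.truncn e^-1; exists m => //.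
  have [ib xib] := bnd_face (EB _ Ex); exists ib => //; split=> // d d0.
  apply: contrapT => H; apply: nd; exists d => // q Bq qd.
  apply: contrapT => H'; apply: H; exists q; split=> // z Ez.
  rewrite ltNge; apply/negP => zq; apply: H'; exists z => //.
  rewrite (le_trans zq)// ler_wpM2r ?enorm_ge0//.
  rewrite invf_ple ?posrE//; apply: ltW.
  by have /truncn_itv/andP[] : 0 <= e^-1 by rewrite invr_ge0 ltW.
apply: le_trans (hausdorff_sigma_subadditive _ _) _.
rewrite eseries0// => m _ _; apply/eqP; rewrite eq_le hausdorff_ge0 andbT.
apply: le_trans (outer_measure_fin_subadditive (hausdorff n.-1) (@subset_refl _
  _)) _.
rewrite big1// => ib _.
apply: (porous_hausdorff0 cU r0p Ur0 Ur1 ib.1 (sgn2 ib.2) r1_ge0).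
by rewrite invr_gt0.
Qed.

End boundary_density.

(** * Additivity of the functionals *)

Section additivity.
Variables (R : realType) (n : nat).
Local Notation V := 'rV[R]_n.
Local Notation mu := (hausdorff_measure R n n.-1).
Local Notation H := (hausdorff n.-1 : {outer_measure set V -> \bar R}).
Local Notation T := (caratheodory_type H).
Implicit Types (K L M A : set V).

Lemma closed_measurable A : closed A ->
  measurable (A : set T).
Proof. exact: hausdorff_closed_measurable. Qed.

Lemma bnd_measurable A : closed A -> measurable (bnd A : set T).
Proof.
move=> cA; rewrite closed_bndE// setDE; apply: closed_measurable.
by apply: closedI => //; apply: open_closedC; exact: open_interior.
Qed.

Lemma null_measurable A : hausdorff n.-1 A = 0%E ->
  measurable (A : set T).
Proof.
move=> A0; apply: le_caratheodory_measurable => X.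
rewrite -[leRHS]add0e; apply: leeD; last exact: le_outer_measure.
by rewrite -A0; exact: (le_hausdorff n.-1 (@subIsetr _ X A)).
Qed.

(** The quantitative content of having an inner rolling ball and the origin as an
    interior point; [r0] and [r1] refer to the sup norm. *)
Record smooth_body K (r r0 r1 : R) : Prop := SmoothBody {
  smooth_closed : closed K;
  smooth_convex : @convex_set R V K;
  smooth_touch : forall x, bnd K x -> touch K x (normal K x) r;
  smooth_r_gt0 : 0 < r;
  smooth_r0_gt0 : 0 < r0;
  smooth_inner : forall z, `|z| <= r0 -> K z;
  smooth_outer : forall z, K z -> `|z| <= r1 }.

Lemma rolling_smooth K : rolling_bodies R n K -> exists r r0 r1, smooth_body K
  r r0 r1.
Proof.
move=> [[[cK xK _] /interior_eballP[r0 r0p r0K]] [r rp rK] _].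
have [r1 [_ /(_ (`|r1| + 1)) r1K]] := compact_bounded cK.
exists r, (r0 / n.+1%:R), (`|r1| + 1); split=> //.
- by apply: compact_closed => //; exact: norm_hausdorff.
- by move=> x Kx; apply: rolling_touch => //; exact: rK.
- by rewrite divr_gt0.
- move=> z zr; apply: r0K; rewrite /eball /= subr0.
  rewrite (le_trans (enorm_le_norm _))//; move: zr; rewrite ler_pdivlMr//.
  by apply: le_trans; rewrite mulrC ler_wpM2l// ler_nat.
- by apply: r1K; rewrite ltr_pwDr// ler_norm.
Qed.

Section one_body.
Variables (K : set V) (r r0 r1 : R).
Hypothesis bK : smooth_body K r r0 r1.

Lemma smooth_bndE : bnd K = K `\` K°.
Proof. by apply: closed_bndE; case: bK. Qed.

Lemma smooth_bnd_finite : (hausdorff n.-1 (bnd K) < +oo)%E.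
Proof.
by rewrite smooth_bndE; case: bK => *; apply: bnd_hausdorff_finite; eassumption.
Qed.

Lemma smooth_interior0 : K° 0.
Proof.
case: bK => cK xK tK rp r0p r0K r1K; apply/interior_eballP; exists r0 => // z.
rewrite /eball /= subr0 => zr; apply: r0K.
exact: le_trans (norm_le_enorm _) zr.
Qed.

Lemma smooth_density_bounded (p : R) m k : 0 <= p / (n%:R + p) ->
  bounded_on (bnd K) (W_density p m k K).
Proof.
case: bK => cK xK tK rp r0p r0K r1K p0.
have [|z /r1K zr|C HC] := @W_density_bounded R n p m k K r r0 (n%:R * r1) p0 rp
  r0p.
- move=> z; rewrite /eball /= subr0 => zr; apply/r0K.
  exact: le_trans (norm_le_enorm _) zr.
- rewrite /eball /= subr0 (le_trans (enorm_le_norm _))//.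
  by rewrite ler_wpM2l.
- by exists C => x /tK; exact: HC.
Qed.

End one_body.

Section two_bodies.
Variables (K L : set V) (r r0 r1 r' r0' r1' : R).
Hypotheses (bK : smooth_body K r r0 r1) (bL : smooth_body L r' r0' r1').
Hypothesis cU : @convex_set R V (K `|` L).
Local Notation U := (K `|` L).
Local Notation P := (K `&` L).
Local Notation E := (bnd K `&` bnd L).

Let rho := Num.min r r'.

Let closedK : closed K. Proof. by case: bK. Qed.
Let closedL : closed L. Proof. by case: bL. Qed.
Let closed_union : closed U. Proof. exact: closedU. Qed.
Let closed_inter : closed P. Proof. exact: closedI. Qed.

Let convexP : @convex_set R V P.
Proof.
move=> x y l; rewrite !inE => -[Kx Lx] [Ky Ly].
have xK := smooth_convex bK; have xL := smooth_convex bL.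
by split; [have := xK x y l|have := xL x y l]; rewrite !inE; apply.
Qed.

(** The common normal of [K] and [L] is a normal of the union, and the smaller of
    the two touching balls lies in the intersection. *)
Lemma common_touch x : E x -> exists2 N, touch P x N rho & touch U x N rho.
Proof.
move=> [xK xL]; have tK := smooth_touch bK xK; have tL := smooth_touch bL xL.
have NN := common_normal cU (smooth_interior0 bK) (smooth_interior0 bL) tK tL.
rewrite -NN in tL; exists (normal K x).
  have [rp [N1 NK] iK] := tK; have [rp' _ iL] := tL.
  split; first by rewrite lt_min rp.
    by split=> // y [/NK].
  move=> z zr; split; [apply: iK|apply: iL]; apply: sub_eball_touching zr => //.
    by rewrite ge_min lexx.
  by rewrite ge_min lexx orbT.
have [rp [N1 NK] iK] := tK; have [rp' [_ NL] iL] := tL.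
split; first by rewrite lt_min rp.
  by split=> // y [/NK|/NL].
move=> z zr; left; apply: iK; apply: sub_eball_touching zr => //.
by rewrite ge_min lexx.
Qed.

Lemma bndK_split : bnd K = E `|` ((bnd K `&` L°) `|` (bnd K `\` L)).
Proof.
rewrite !closed_bndE//; apply/seteqP; split=> [x [Kx Kx']|x];
  last by move=> [[]|[[]|[]]].
have [Lx|Lx] := pselect (L x); last by right; right.
by have [Lx'|Lx'] := pselect (L° x); [right; left|left].
Qed.

Lemma bndU_split : bnd U = E `|` ((bnd K `\` L) `|` (bnd L `\` K)).
Proof.
apply/seteqP; split=> x.
  rewrite !closed_bndE// => -[xU xU'].
  have xK' : ~ K° x by apply: contra_not xU'; apply: interiorS; exact: subsetUl.
  have xL' : ~ L° x by apply: contra_not xU'; apply: interiorS; exact: subsetUr.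
  have [Kx|Kx] := pselect (K x); have [Lx|Lx] := pselect (L x).
  - by left.
  - by right; left.
  - by right; right.
  - by case: xU.
have side M M' : closed M -> closed M' -> (bnd M `\` M') x -> ~ (M `|` M')° x.
  move=> cM cM' [Mx M'x] xU; move: Mx; rewrite closed_bndE// => -[Mx]; apply.
  have xM' : nbhs x (~` M').
    by apply: open_nbhs_nbhs; split=> //; exact: closed_openC.
  by apply: filterS2 xU xM' => y [].
case=> [Ex|[KL|LK]].
- by have [N _ tU] := common_touch Ex; exact: touch_bnd tU.
- rewrite closed_bndE//; split; last exact: side KL.
  by left; case: KL; rewrite closed_bndE// => -[].
- rewrite closed_bndE//; split; last by rewrite setUC; exact: side LK.
  by right; case: LK; rewrite closed_bndE// => -[].
Qed.

Lemma bndP_split : bnd P = E `|` ((bnd K `&` L°) `|` (bnd L `&` K°)).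
Proof.
rewrite !closed_bndE// interiorI; apply/seteqP; split=> x.
  move=> [[Kx Lx] nI].
  have [Kx'|Kx'] := pselect (K° x); have [Lx'|Lx'] := pselect (L° x).
  - by case: nI.
  - by right; right.
  - by right; left.
  - by left.
move=> [[[Kx nK] [Lx nL]]|[[[Kx nK] Lx]|[[Lx nL] Kx]]].
- by split=> // -[].
- by split=> [|[]//]; split=> //; exact: interior_subset Lx.
- by split=> [|[]//]; split=> //; exact: interior_subset Kx.
Qed.

Variables (p : R) (m k : nat).
Local Notation W := (W_density p m k).

Lemma W_outside x : (bnd K `\` L) x -> W U x = W K x.
Proof.
move=> [xK xL]; have tK := smooth_touch bK xK.
have [d d0 dL] := open_eball (closed_openC closedL) xL.
apply/esym/(W_density_agree _ _ _ closedK closed_union cU d0 tK) => z /dL Lz.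
by split=> [|[]//]; left.
Qed.

Lemma W_inside x : (bnd K `&` L°) x -> W P x = W K x.
Proof.
move=> [xK /interior_eballP[d d0 dL]]; have tK := smooth_touch bK xK.
apply/esym/(W_density_agree _ _ _ closedK closed_inter convexP d0 tK) => z /dL
  Lz.
by split=> [|[]].
Qed.

End two_bodies.

Section common_integrand.
Variables (K L : set V) (r r0 r1 r' r0' r1' : R).
Hypotheses (bK : smooth_body K r r0 r1) (bL : smooth_body L r' r0' r1').
Hypothesis cU : @convex_set R V (K `|` L).
Local Notation U := (K `|` L).
Local Notation P := (K `&` L).
Local Notation E := (bnd K `&` bnd L).
Variables (p : R) (m k : nat).
Hypothesis p0 : 0 <= p / (n%:R + p).
Local Notation W := (W_density p m k).

Let rho := Num.min r r'.
Let closedK : closed K. Proof. by case: bK. Qed.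
Let closedL : closed L. Proof. by case: bL. Qed.
Let closed_union : closed U. Proof. exact: closedU. Qed.
Let closed_inter : closed P. Proof. exact: closedI. Qed.
Let cU' : @convex_set R V (L `|` K). Proof. by rewrite setUC. Qed.

Let Z := [set x | E x /\ ~ relatively_dense_at E (U `\` U°) x].

Let Z0 : hausdorff n.-1 Z = 0%E.
Proof.
have rK := bK; case: rK => cK xK _ _ r0p r0K r1K.
apply: (@not_dense_hausdorff0 R n U r0 (Num.max r1 r1')) => //.
- by move=> z /r0K; left.
- by move=> z [/r1K|/(smooth_outer bL)] zr; rewrite le_max zr ?orbT.
- by move=> x Ex; rewrite -(closed_bndE closed_union) (bndU_split bK bL cU);
  left.
Qed.

Let W_between M x : P `<=` M -> M `<=` U -> E x -> ~ Z x -> W M x = W U x.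
Proof.
move=> PM MU Ex nZ; have [N tP tU] := common_touch bK bL cU Ex.
have dx : relatively_dense_at E (bnd U) x.
  by rewrite (closed_bndE closed_union); apply: contrapT => nd; apply: nZ.
have PU : P `<=` U by move=> y [Ky _]; left.
have Etouch e : E e -> exists2 u, touch P e u rho & touch U e u rho.
  exact: (common_touch bK bL cU).
have := osculate_dense closed_union PU Etouch tP tU dx.
move=> /(osculate_between PM MU tP tU).
exact: W_density_osculate (touch_between PM MU tP tU) tU.
Qed.

(** A single integrand serves the four bodies: off a null set, the density of
    each of them is that of [K] on the boundary of [K], and that of [L] on the
    rest of the boundary of [L]. *)
Let g x := if x \in bnd K then W K x else W L x.

Let int_g M : closed M -> E `<=` bnd M ->
  (forall x, bnd M x -> ~ Z x -> W M x = g x) ->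
  steiner_W p m k M = \int[mu]_(x in bnd M) g x.
Proof.
move=> cM EM Mg; apply: (@lower_Rintegral_ae_eq _ _ _ mu (bnd M) Z) => //.
- exact: bnd_measurable.
- exact: null_measurable.
- by move=> x [/EM].
Qed.

Let gK x : bnd K x -> g x = W K x.
Proof. by move=> xK; rewrite /g ifT// inE. Qed.

Let gL x : ~ bnd K x -> g x = W L x.
Proof. by move=> xK; rewrite /g ifF//; apply/negbTE; rewrite notin_setE. Qed.

Let W_K x : E x -> ~ Z x -> W K x = W U x.
Proof. by apply: W_between => y; [case|left]. Qed.

Let W_L x : E x -> ~ Z x -> W L x = W U x.
Proof. by apply: W_between => y; [case|right]. Qed.

Let W_P x : E x -> ~ Z x -> W P x = W U x.
Proof. by apply: W_between => y; [|case=> ? _; left]. Qed.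

Let steiner_WK : steiner_W p m k K = \int[mu]_(x in bnd K) g x.
Proof. by apply: int_g; [|move=> x []|move=> x xK _; rewrite gK]. Qed.

Let steiner_WL : steiner_W p m k L = \int[mu]_(x in bnd L) g x.
Proof.
apply: int_g; [by []|by move=> x []|move=> x xL nZ].
have [xK|xK] := pselect (bnd K x); last by rewrite gL.
have Ex : E x by split.
by rewrite (gK xK) (W_K Ex nZ) (W_L Ex nZ).
Qed.

Let NbndK_interior x : K° x -> ~ bnd K x.
Proof. by move=> xK; rewrite closed_bndE// => -[]. Qed.

Let NbndK_out x : ~ K x -> ~ bnd K x.
Proof. by move=> xK; rewrite closed_bndE// => -[]. Qed.

Let steiner_WU : steiner_W p m k U = \int[mu]_(x in bnd U) g x.
Proof.
apply: int_g => //.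
  by rewrite (bndU_split bK bL cU); left.
move=> x; rewrite (bndU_split bK bL cU) => -[Ex|[KL|LK]] nZ.
- by case: (Ex) => xK _; rewrite (gK xK) (W_K Ex nZ).
- by case: (KL) => xK _; rewrite (gK xK); exact: (W_outside bK bL cU).
- case: (LK) => _ xK; rewrite gL; last exact: NbndK_out.
  by rewrite setUC; exact: (W_outside bL bK cU').
Qed.

Let steiner_WP : steiner_W p m k P = \int[mu]_(x in bnd P) g x.
Proof.
apply: int_g => //; first by rewrite (bndP_split bK bL); left.
move=> x; rewrite (bndP_split bK bL) => -[Ex|[KL|LK]] nZ.
- by case: (Ex) => xK _; rewrite (gK xK) (W_P Ex nZ) (W_K Ex nZ).
- by case: (KL) => xK _; rewrite (gK xK); exact: (W_inside bK bL).
- case: (LK) => _ xK; rewrite gL; last exact: NbndK_interior.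
  by rewrite setIC; exact: (W_inside bL bK).
Qed.

(** [g] may fail to be measurable, but it is bounded and the pieces have finite
    measure, so the lower integrals are finite and additive. *)
Let int_split (A B C : set V) : measurable (A : set T) -> measurable (B : set
  T) ->
  measurable (C : set T) -> A `<=` bnd K `|` bnd L -> B `<=` bnd K `|` bnd L ->
  C `<=` bnd K `|` bnd L ->
  A `&` B `<=` set0 -> A `&` C `<=` set0 -> B `&` C `<=` set0 ->
  \int[mu]_(x in A `|` (B `|` C)) g x =
  \int[mu]_(x in A) g x + (\int[mu]_(x in B) g x + \int[mu]_(x in C) g x).
Proof.
have fin D : D `<=` bnd K `|` bnd L -> (mu D < +oo)%E.
  move=> DKL; apply: le_lt_trans (le_hausdorff n.-1 DKL) _.
  apply: le_lt_trans (outer_measureU2 H _ _) _.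
  by apply: lte_add_pinfty;
    [exact: smooth_bnd_finite bK|exact: smooth_bnd_finite bL].
have bdd D : D `<=` bnd K `|` bnd L -> bounded_on D g.
  have [c Hc] := smooth_density_bounded bK m k p0.
  have [c' Hc'] := smooth_density_bounded bL m k p0.
  move=> DKL; exists (Num.max c c') => x /DKL xKL; rewrite le_max.
  have [xK|xK] := pselect (bnd K x); first by rewrite gK// Hc.
  by rewrite gL// Hc' ?orbT//; case: xKL.
move=> mA mB mC A0 B0 C0 AB AC BC.
have BCs : B `|` C `<=` bnd K `|` bnd L by move=> x [/B0|/C0].
rewrite lower_Rintegral_setU//;
  [|exact: measurableU|exact: fin|exact: fin| |exact: bdd|exact: bdd].
  by rewrite lower_Rintegral_setU//;
    [exact: fin|exact: fin|exact/disj_setPS|exact: bdd|exact: bdd].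
by apply/disj_setPS => x [Ax [Bx|Cx]]; [apply: (AB x)|apply: (AC x)].
Qed.

Lemma steiner_W_union_intersection :
  steiner_W p m k U + steiner_W p m k P = steiner_W p m k K + steiner_W p m k L.
Proof.
rewrite steiner_WU steiner_WP steiner_WK steiner_WL.
rewrite (bndU_split bK bL cU) (bndP_split bK bL) [X in _ = Rintegral _ X _ +
  _](bndK_split bK bL).
rewrite [X in _ = _ + Rintegral _ X _](bndK_split bL bK) (setIC (bnd L) (bnd
  K)).
have mK : measurable (bnd K : set T) by exact: bnd_measurable.
have mL : measurable (bnd L : set T) by exact: bnd_measurable.
have mE : measurable (E : set T) by exact: measurableI.
have mC A : closed A -> measurable (A : set T) by exact: closed_measurable.
have mO A : measurable (A° : set T).
  rewrite -[A°]setCK; apply: measurableC; apply: closed_measurable.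
  by apply: open_closedC; exact: open_interior.
have mKL : measurable (bnd K `\` L : set T) by apply: measurableD => //;
  exact: mC.
have mLK : measurable (bnd L `\` K : set T) by apply: measurableD => //;
  exact: mC.
have mKl : measurable (bnd K `&` L° : set T) by exact: measurableI.
have mLk : measurable (bnd L `&` K° : set T) by exact: measurableI.
have nK x : bnd K x -> K x /\ ~ K° x by rewrite closed_bndE.
have nL x : bnd L x -> L x /\ ~ L° x by rewrite closed_bndE.
rewrite !int_split//; first by ring.
all: move=> x; have := nK x; have := nL x;
  rewrite /set0 /setI /setD /setU /mkset.
all: by have := @interior_subset _ K x; have := @interior_subset _ L x; tauto.
Qed.

End common_integrand.
Lemma steiner_W_valuation (p : R) m k : 0 <= p / (n%:R + p) ->
  valuation_on (rolling_bodies R n) (steiner_W p m k).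
Proof.
move=> p0 K L /rolling_smooth[r [r0 [r1 bK]]] /rolling_smooth[r' [r0' [r1'
  bL]]] cU.
exact: (steiner_W_union_intersection bK bL cU m k p0).
Qed.

Lemma steiner_V_valuation (p : R) k : 0 <= p / (n%:R + p) ->
  valuation_on (rolling_bodies R n) (steiner_V p k).
Proof.
move=> p0 K L CK CL cU; rewrite /steiner_V -[LHS]big_split -[RHS]big_split.
apply: eq_bigr => m _.
rewrite /=; have := steiner_W_valuation m k p0 CK CL cU.
by move: (steiner_W _ _ _ _) (steiner_W _ _ _ _) (steiner_W _ _ _ _)
  (steiner_W _ _ _ _) => a b c d abcd; rewrite -mulrDr abcd mulrDr.
Qed.

End additivity.

Theorem theorem5 (R : realType) (n : nat) (p : R)
    (hn : (2 <= n)%N) (hp : (0 <= p) \/ (p < - n%:R))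
    (k m : nat) (hk : (1 <= k)%N) (hm : (1 <= m)%N) :
  valuation_on (rolling_bodies R n) (steiner_W p m k) /\
  valuation_on (rolling_bodies R n) (steiner_V p k).
Proof.
have p0 : 0 <= p / (n%:R + p).
  case: hp => [p0|pn]; first by rewrite divr_ge0// addr_ge0.
  have n0 : 0 <= n%:R :> R by [].
  (* numerator and denominator are both negative *)
  by rewrite -mulrNN -invrN divr_ge0//; lra.
by split; [exact: steiner_W_valuation|exact: steiner_V_valuation].
Qed.
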